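(* Let $r\ge1$, $\mathbf n=(n_1,\dots,n_r)$, $\mathbf m=(m_1,\dots,m_r)\in\mathbb N_0^r$, and let $\mathbf a=(a_1,\dots,a_{r+1})$, $\mathbf b=(b_1,\dots,b_{r+1})$ be real with $a_j,b_j>0$ for $j=1,\dots,r+1$. Put $$W_r(\boldsymbol x,\mathbf a,\mathbf b)=\prod_{j=1}^r\Gamma\Big(a_j-\frac{ix_j}{2}\Big)\Gamma\Big(|\mathbf a^{j+1}|+\frac{ix_j}{2}\Big)\Gamma\Big(b_j+\frac{ix_j}{2}\Big)\Gamma\Big(|\mathbf b^{j+1}|-\frac{ix_j}{2}\Big)$$ and, for $\boldsymbol x\in\mathbb C^r$, $${}_rS_{\mathbf n}(\boldsymbol x;\mathbf a,\mathbf b)=\prod_{j=1}^r\left\{\Big(|\mathbf a^{j+1}|+\frac{x_j}{2}\Big)_{|\mathbf n^{j+1}|}\;{}_3F_2\left(\begin{matrix}-n_j,\;n_j+2|\mathbf n^{j+1}|+|\mathbf a^j|+|\mathbf b^j|-1,\;|\mathbf n^{j+1}|+|\mathbf a^{j+1}|+\frac{x_j}{2}\\ 2|\mathbf n^{j+1}|+|\mathbf a^{j+1}|+|\mathbf b^{j+1}|,\;|\mathbf n^{j+1}|+|\mathbf a^j|\end{matrix}\,\Big|\,1\right)\right\},$$ or, equivalently, in terms of continuous Hahn polynomials, $${}_rS_{\mathbf n}(\boldsymbol x;\mathbf a,\mathbf b)=\prod_{j=1}^r\left\{\frac{n_j!\,i^{-n_j}\big(|\mathbf a^{j+1}|+\frac{x_j}{2}\big)_{|\mathbf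 n^{j+1}|}}{\big(|\mathbf n^{j+1}|+|\mathbf a^j|\big)_{n_j}\big(2|\mathbf n^{j+1}|+|\mathbf a^{j+1}|+|\mathbf b^{j+1}|\big)_{n_j}}\;p_{n_j}\Big(\frac{-ix_j}{2};|\mathbf n^{j+1}|+|\mathbf a^{j+1}|,\,b_j,\,|\mathbf n^{j+1}|+|\mathbf b^{j+1}|,\,a_j\Big)\right\}.$$ Then $$\int_{\mathbb R^r}W_r(\boldsymbol x,\mathbf a,\mathbf b)\;{}_rS_{\mathbf n}(i\boldsymbol x;\mathbf a,\mathbf b)\;{}_rS_{\mathbf m}(-i\boldsymbol x;\mathbf b,\mathbf a)\,d\boldsymbol x=2^{2r}\pi^r\,h_{\mathbf n}^{(\mathbf a+\mathbf b-\mathbf 1)}\prod_{j=1}^r\frac{(n_j!)^2\,\Gamma\big(|\mathbf n^{j+1}|+|\mathbf a^j|\big)\Gamma\big(|\mathbf n^{j+1}|+|\mathbf b^j|\big)}{\Big(\big(2|\mathbf n^{j+1}|+|\mathbf a^{j+1}|+|\mathbf b^{j+1}|\big)_{n_j}\Big)^2}\;\delta_{n_j,m_j},$$ where $\mathbf a+\mathbf b-\mathbf 1=(a_1+b_1-1,\dots,a_{r+1}+b_{r+1}-1)$.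
   Context: Notation: $\mathbb N_0=\{0,1,2,\dots\}$; $(c)_k=c(c+1)\cdots(c+k-1)$, $(c)_0=1$; $\delta$ is the Kronecker delta; ${}_3F_2\left(\begin{matrix}c_1,c_2,c_3\\ d_1,d_2\end{matrix}\Big|z\right)=\sum_{k\ge0}\frac{(c_1)_k(c_2)_k(c_3)_k}{(d_1)_k(d_2)_k}\frac{z^k}{k!}$ (a finite sum when $c_1=-n$, $n\in\mathbb N_0$). $|\mathbf n^j|=n_j+\cdots+n_r$ with $|\mathbf n^{r+1}|=0$ (and similarly for $\mathbf m$), $|\mathbf a^j|=a_j+\cdots+a_{r+1}$, $|\mathbf b^j|=b_j+\cdots+b_{r+1}$. Continuous Hahn polynomials: $p_n(x;a,b,c,d)=i^n\frac{(a+c)_n(a+d)_n}{n!}\;{}_3F_2\left(\begin{matrix}-n,\;n+a+b+c+d-1,\;a+ix\\ a+c,\;a+d\end{matrix}\Big|1\right)$. For $\alpha=(\alpha_1,\dots,\alpha_{r+1})$ with $\alpha_j>-1$ and $|\alpha^j|=\alpha_j+\cdots+\alpha_{r+1}$, the constant $h_{\mathbf n}^{(\alpha)}$ is $$h_{\mathbf n}^{(\alpha)}=\prod_{j=1}^r\frac{\Gamma\big(2|\mathbf n^{j+1}|+|\alpha^{j+1}|+r-j+1+n_j\big)\,\Gamma(1+\alpha_j+n_j)}{n_j!\,\big(2|\mathbf n^{j+1}|+|\alpha^{j+1}|+r-j+1+\alpha_j+2n_j\big)\,\Gamma\big(2|\mathbf n^{j+1}|+|\alpha^{j+1}|+r-j+1+\alpha_j+n_j\big)}.$$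 *)

(* Defs.v *)
From HB Require Import structures.
From mathcomp Require Import all_boot all_order all_algebra.
From mathcomp Require Import all_classical all_reals all_analysis.
From mathcomp Require Import complex.

Set Implicit Arguments.
Unset Strict Implicit.
Unset Printing Implicit Defensive.

Import Order.TTheory GRing.Theory Num.Theory.
Import numFieldNormedType.Exports.

Local Open Scope classical_set_scope.
Local Open Scope ring_scope.
Local Open Scope complex_scope.

(* [R^r], with the product of the Borel sigma-algebras on which
   [lebesgue_measure] is defined. *)
Notation euclidean R r := (r.-tuple (measurableTypeR R)).

Section lebesgue_step.
Variables (R : realType) (r : nat).
Variable mu : {sigma_finite_measure set (euclidean R r) -> \bar R}.

Let pm : {measure set (measurableTypeR R * euclidean R r)%type -> \bar R} :=
  (lebesgue_measure \x mu)%E.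

Definition euclidean_cons (p : (measurableTypeR R * euclidean R r)%type) :
  euclidean R r.+1 := [tuple of p.1 :: p.2].

Lemma measurable_euclidean_cons : measurable_fun setT euclidean_cons.
Proof. exact: measurable_cons. Qed.

Definition lebesgue_step : set (euclidean R r.+1) -> \bar R :=
  pushforward (lebesgue_measure \x mu)%E euclidean_cons.

Let lebesgue_step0 : lebesgue_step set0 = 0%E.
Proof. by rewrite /lebesgue_step /pushforward preimage_set0 (measure0 pm). Qed.

Let lebesgue_step_ge0 A : (0 <= lebesgue_step A)%E.
Proof. exact: (measure_ge0 pm). Qed.

Let lebesgue_step_sigma_additive : semi_sigma_additive lebesgue_step.
Proof.
exact: (@measure_semi_sigma_additive _ _ _
  (measure_function_pushforward__canonical__measure_function_Measure
     pm measurable_euclidean_cons)).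
Qed.

HB.instance Definition _ := isMeasure.Build _ _ _ lebesgue_step
  lebesgue_step0 lebesgue_step_ge0 lebesgue_step_sigma_additive.

Let lebesgue_step_sigma_finite : sigma_finite setT lebesgue_step.
Proof.
have /sigma_finiteP[F [TF ndF Foo]] := sigma_finiteT (@lebesgue_measure R).
have /sigma_finiteP[G [TG ndG Goo]] := sigma_finiteT mu.
pose u (v : euclidean R r.+1) : measurableTypeR R * euclidean R r :=
  (thead v, [tuple of behead v]).
have mesu : measurable_fun setT u.
  apply/measurable_fun_pairP; split => /=.
    exact: measurable_tnth.
  exact: measurable_behead.
have uK p : u (euclidean_cons p) = p.
  by case: p => x v; congr pair => /=; apply/val_inj.
exists (fun k => u @^-1` (F k `*` G k)).
  rewrite -preimage_bigcup (_ : \bigcup_k _ = setT) ?preimage_setT//.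
  apply/seteqP; split => // -[x v] _.
  have [k _ Fkx] : (\bigcup_i F i) x by rewrite -TF.
  have [l _ Glv] : (\bigcup_i G i) v by rewrite -TG.
  exists (maxn k l) => //; split => /=.
    by move: (x) Fkx; exact/subsetPset/ndF/leq_maxl.
  by move: (v) Glv; exact/subsetPset/ndG/leq_maxr.
move=> k; have [mF Fk] := Foo k; have [mG Gk] := Goo k.
split.
  rewrite -[X in measurable X]setTI.
  by apply: mesu => //; exact: measurableX.
rewrite /lebesgue_step /pushforward.
rewrite (_ : _ @^-1` _ = F k `*` G k); last first.
  by rewrite -comp_preimage (_ : u \o _ = id)//; exact/funext.
by rewrite product_measure1E// lte_mul_pinfty// ge0_fin_numE.
Qed.

HB.instance Definition _ := Measure_isSigmaFinite.Build _ _ _ lebesgue_step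
  lebesgue_step_sigma_finite.

End lebesgue_step.

Fixpoint lebesgue_measure_n (R : realType) (r : nat) :
    {sigma_finite_measure set (euclidean R r) -> \bar R} :=
  if r is r'.+1 then lebesgue_step (lebesgue_measure_n R r')
  else \d_([tuple] : euclidean R 0).

Section complex_integral.
Variables (d : measure_display) (T : measurableType d) (R : realType).
Variables (mu : {measure set T -> \bar R}) (D : set T) (f : T -> R[i]).

Definition cintegrable : Prop :=
  mu.-integrable D (fun x => (complex.Re (f x))%:E) /\
  mu.-integrable D (fun x => (complex.Im (f x))%:E).

Definition cintegral : R[i] :=
  (\int[mu]_(x in D) complex.Re (f x)) +i* (\int[mu]_(x in D) complex.Im (f x)).

End complex_integral.

Section special_functions.
Variable R : realType.
Implicit Types (c d z : R[i]) (k n : nat).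

Definition poch c k : R[i] := \prod_(i < k) (c + i%:R).

(* [t] to the power [z], for [t > 0] *)
Definition rpow (t : R) z : R[i] :=
  (t `^ complex.Re z)%:C * (cos (complex.Im z * ln t) +i* sin (complex.Im z * ln t)).

(* Euler's integral, which converges for [0 < Re z] *)
Definition euler_integral z : R[i] :=
  cintegral (@lebesgue_measure R) `]0, +oo[%classic
    (fun t : measurableTypeR R => (expR (- t))%:C * rpow t (z - 1)).

(* The Gamma function on [C] minus the nonpositive integers: Euler's integral,
   extended to [Re z <= 0] by [Gamma z = Gamma (z + k) / (z)_k].  The value at
   the poles is meaningless (division by [0]). *)
Definition Gamma z : R[i] :=
  let k := if 0 < complex.Re z then 0%N else (Num.truncn (- complex.Re z)).+1 in
  euler_integral (z + k%:R) / poch z k.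

Definition hyp3F2 c1 c2 c3 d1 d2 z : R[i] :=
  limn (series (fun k => poch c1 k * poch c2 k * poch c3 k
                         / (poch d1 k * poch d2 k)
                         * (z ^+ k / k`!%:R)) : nat -> R[i]^o).

Definition continuous_hahn n (x a b c d : R[i]) : R[i] :=
  'i%C ^+ n * (poch (a + c) n * poch (a + d) n / n`!%:R)
  * hyp3F2 (- n%:R) (n%:R + a + b + c + d - 1) (a + 'i%C * x) (a + c) (a + d) 1.

End special_functions.

(* Indices are shifted by one with respect to the usual [1 <= j <= r]:
   [j : 'I_r] stands for the (j+1)-st index.  Thus, if [J = j + 1],
   [ntail n j] is [n_J + ... + n_r], [ntail n j.+1] is [n_(J+1) + ... + n_r],
   and likewise for [rtail]. *)
Definition ntail (r : nat) (n : 'I_r -> nat) (k : nat) : nat :=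
  (\sum_(i < r | k <= i) n i)%N.

Definition rtail (R : realType) (N : nat) (a : 'I_N -> R) (k : nat) : R :=
  \sum_(i < N | (k <= i)%N) a i.

Definition entry (R : realType) (r : nat) (a : 'I_r.+1 -> R) (j : 'I_r) : R :=
  a (widen_ord (leqnSn r) j).

Section families.
Variables (R : realType) (r : nat).
Implicit Types (n : 'I_r -> nat) (a b alpha : 'I_r.+1 -> R).

Definition weight (x : 'I_r -> R) a b : R[i] :=
  \prod_(j < r)
    (Gamma ((entry a j)%:C - 'i%C * (x j)%:C / 2)
     * Gamma ((rtail a j.+1)%:C + 'i%C * (x j)%:C / 2)
     * Gamma ((entry b j)%:C + 'i%C * (x j)%:C / 2)
     * Gamma ((rtail b j.+1)%:C - 'i%C * (x j)%:C / 2)).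

Definition S_fun n (x : 'I_r -> R[i]) a b : R[i] :=
  \prod_(j < r)
    (let N : R[i] := (ntail n j.+1)%:R in
     poch ((rtail a j.+1)%:C + x j / 2) (ntail n j.+1)
     * hyp3F2 (- (n j)%:R)
              ((n j)%:R + 2 * N + (rtail a j)%:C + (rtail b j)%:C - 1)
              (N + (rtail a j.+1)%:C + x j / 2)
              (2 * N + (rtail a j.+1)%:C + (rtail b j.+1)%:C)
              (N + (rtail a j)%:C)
              1).

Definition S_fun_hahn n (x : 'I_r -> R[i]) a b : R[i] :=
  \prod_(j < r)
    (let N : R[i] := (ntail n j.+1)%:R in
     (n j)`!%:R * 'i%C ^- n j
     * poch ((rtail a j.+1)%:C + x j / 2) (ntail n j.+1)
     / (poch (N + (rtail a j)%:C) (n j)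
        * poch (2 * N + (rtail a j.+1)%:C + (rtail b j.+1)%:C) (n j))
     * continuous_hahn (n j) (- 'i%C * x j / 2)
         (N + (rtail a j.+1)%:C) (entry b j)%:C
         (N + (rtail b j.+1)%:C) (entry a j)%:C).

(* [(c + 2k) Gamma (c + k)].  At [k = c = 0] this has a removable singularity
   and is given its limit [Gamma 1 = 1]. *)
Definition h_den (c : R) (k : nat) : R[i] :=
  if (k == 0%N) && (c == 0) then 1
  else (c + 2 * k%:R)%:C * Gamma (c + k%:R)%:C.

Definition h_const n alpha : R[i] :=
  \prod_(j < r)
    (let c : R := 2 * (ntail n j.+1)%:R + rtail alpha j.+1 + (r - j)%:R in
     Gamma (c + (n j)%:R)%:C * Gamma (1 + entry alpha j + (n j)%:R)%:C
     / ((n j)`!%:R * h_den (c + entry alpha j) (n j))).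

End families.

(* Main.v *)
Require Import Defs.
From HB Require Import structures.
From mathcomp Require Import all_boot all_order all_algebra.
From mathcomp Require Import all_classical all_reals all_analysis.
From mathcomp Require Import complex.
From mathcomp Require Import measurable_realfun.
From mathcomp Require Import ring lra zify.
Import Order.TTheory GRing.Theory Num.Theory.
Import numFieldNormedType.Exports.
Local Open Scope classical_set_scope.
Local Open Scope ring_scope.
Local Open Scope complex_scope.

(* The integrand factors over the coordinates, so by Fubini the integral is a
   product of integrals over R.  The j-th one is a finite double sum, with
   coefficients from the two 3F2's, of Barnes integrals of
   Gamma (a + i x) Gamma (b + i x) Gamma (c - i x) Gamma (d - i x), because the
   Pochhammer symbols are absorbed by the Gamma functions.

   Barnes' first lemma comes from Fourier analysis.  With t = exp u,
   Gamma (a + i x) is the Fourier transform of u |-> exp (a u - exp u), so the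
   product of the four Gamma functions is the transform of a convolution whose
   value at 0 is a beta integral.  Fourier inversion at 0 (by Abel summation)
   gives the integral; the decay needed for it comes from
   Gamma (z + 1) = z Gamma z.

   In the double sum, when the tails n_(j+1) + ... + n_r and m_(j+1) + ... + m_r
   agree, the sum over k is an n_j-th finite difference of a polynomial of
   degree < n_j unless l >= n_j.  Hence the integral vanishes for the largest j
   with n_j <> m_j, and if there is none only k-sums with l = n_j survive; these
   are evaluated by partial fractions. *)

(** The two polynomials are expanded along different Gamma factors, one along Γ(α + ix/2), the other
    along Γ(β - ix/2). After Barnes' lemma the indices k and l are therefore coupled only through
    Γ(σ+k+l)/Γ(σ+t+k+l), where σ = 2N + α + β for the common tail N and t = a_j + b_j. For fixed l
    the denominators of the 3F2 cancel, and what remains in k is (σ+k)_l (n+σ+t-1)_k / (σ+t+l)_k.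
    The upper parameter n+σ+t-1 makes this a polynomial of degree n-1 when l < n. At l = n it has
    the single denominator k + (n+σ+t-1), which is where the partial fraction enters. If the tails N
    and M differ, the Gamma quotient contains N + M while the polynomials contain 2N and 2M. The
    cancellation is then lost, so the vanishing cannot be proved factor by factor. Each coordinate
    contributes 4π: 2π from Fourier inversion and 2 from the argument x/2. The parameter σ+t-1 is
    only known to exceed -1. It may be zero or negative, which forces separate treatment of degree 0
    in the partial fraction and in [h_den]. *)

Set Implicit Arguments.
Unset Strict Implicit.
Unset Printing Implicit Defensive.

(** * Changes of variables for the Lebesgue measure *)

Section scaling_change_of_variable.
Context {R : realType}.
Local Notation mu := (@lebesgue_measure R).
Variables (phi : measurableTypeR R -> measurableTypeR R) (c : R).
Hypotheses (mphi : measurable_fun setT phi) (c0 : 0 < c).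
Hypothesis phiE : forall a b : R,
  (mu `]a, b]%classic = c%:E * mu (phi @^-1` `]a, b]%classic))%E.

Let pm : {measure set (measurableTypeR R) -> \bar R} :=
  measure_function_pushforward__canonical__measure_function_Measure mu mphi.

Let nu : {measure set (measurableTypeR R) -> \bar R} := mscale (NngNum (ltW c0)) pm.

(** Lebesgue measure is determined by its values on half-open intervals, so [phiE] identifies it
    with [c] times its image under [phi]. *)
Let lebesgue_measure_scaling (A : set (measurableTypeR R)) :
  measurable A -> mu A = nu A.
Proof.
by move=> mA; apply: lebesgue_measure_unique => // _ [[a b]] _ <- /=; exact: phiE.
Qed.

Lemma ge0_integral_scaling (f : R -> \bar R) :
  measurable_fun [set: R] f -> (forall x, 0 <= f x)%E ->
  (\int[mu]_x f x = c%:E * \int[mu]_x f (phi x))%E.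
Proof.
move=> mf f0.
rewrite (eq_measure_integral nu); last by move=> A mA _; exact: lebesgue_measure_scaling.
by rewrite ge0_integral_mscale//= ge0_integral_pushforward.
Qed.

Lemma integrable_scaling (f : R -> R) :
  mu.-integrable setT (EFin \o f) ->
  mu.-integrable setT (EFin \o (fun x => f (phi x))).
Proof.
move=> /integrableP[mf fi]; apply/integrableP; split.
  apply: measurableT_comp => //.
  apply: (@measurableT_comp _ _ _ _ _ _ f) => //.
  exact/measurable_EFinP.
move: fi; rewrite ge0_integral_scaling//; last exact: measurableT_comp.
set I := (X in (_ * X < _ -> X < _)%E).
have : (0 <= I)%E by exact: integral_ge0.
case: I => [r _|_|]; rewrite ?ltry//.
by rewrite gt0_muley// ?lte_fin.
Qed.

Lemma Rintegral_scaling (f : R -> R) :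
  mu.-integrable setT (EFin \o f) ->
  \int[mu]_x f x = c * \int[mu]_x f (phi x).
Proof.
move=> fi; have /integrableP[mf _] := fi.
have fci := integrable_scaling fi.
rewrite /Rintegral -[X in X * _]/(fine c%:E) -fineM//; last first.
  exact: integrable_fin_num fci.
congr fine.
have posE : (\int[mu]_x ((EFin \o f)^\+ x) =
    c%:E * \int[mu]_x ((EFin \o (fun x => f (phi x)))^\+ x))%E.
  rewrite (ge0_integral_scaling (measurable_funepos mf) (funepos_ge0 _)).
  by congr (_ * _)%E; apply: eq_integral => x _; rewrite !funeposE.
have negE : (\int[mu]_x ((EFin \o f)^\- x) =
    c%:E * \int[mu]_x ((EFin \o (fun x => f (phi x)))^\- x))%E.
  rewrite (ge0_integral_scaling (measurable_funeneg mf) (funeneg_ge0 _)).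
  by congr (_ * _)%E; apply: eq_integral => x _; rewrite !funenegE.
transitivity (\int[mu]_x ((EFin \o f)^\+ x) - \int[mu]_x ((EFin \o f)^\- x))%E.
  by rewrite -integralE.
rewrite posE negE -muleBr//; last first.
  by rewrite fin_num_adde_defr//; exact: integrable_pos_fin_num fci.
by rewrite -integralE.
Qed.

End scaling_change_of_variable.

Section affine_reflect.
Context {R : realType}.
Local Notation mu := (@lebesgue_measure R).

Lemma measurable_affine (c t : R) :
  measurable_fun setT (fun x : measurableTypeR R => c * x + t : measurableTypeR R).
Proof.
by apply: measurable_realfun.measurable_funD => //; apply: measurable_funM.
Qed.

Lemma lebesgue_measure_affine (c t : R) (c0 : 0 < c) (a b : R) :
  (mu `]a, b]%classic = c%:E *
    mu ((fun x : measurableTypeR R => c * x + t : measurableTypeR R)%R @^-1`  `]a, b]%classic))%E.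
Proof.
have -> : (fun x : measurableTypeR R => c * x + t) @^-1` `]a, b] = `](a - t) / c, (b - t) / c]%classic.
  apply/seteqP; split => x /=; rewrite !in_itv/= ltr_pdivrMr// ler_pdivlMr//; lra.
rewrite !lebesgue_measure_itv/= !lte_fin ltr_pM2r ?invr_gt0// ltrD2r.
case: ifPn => ab; last by rewrite mule0.
by rewrite -!EFinB -EFinM; congr EFin; field; lra.
Qed.

Lemma lebesgue_measure_reflect (a b : R) :
  (mu `]a, b]%classic = 1%:E *
    mu ((-%R : measurableTypeR R -> measurableTypeR R) @^-1`  `]a, b]%classic))%E.
Proof.
rewrite mul1e -[RHS]/(pushforward mu (-%R : _ -> measurableTypeR R) `]a, b]%classic).
by rewrite lebesgue_measureN.
Qed.

Definition integrable_affine (c t : R) (c0 : 0 < c) :=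
  integrable_scaling (measurable_affine c t) c0 (@lebesgue_measure_affine c t c0).
Definition Rintegral_affine (c t : R) (c0 : 0 < c) :=
  Rintegral_scaling (measurable_affine c t) c0 (@lebesgue_measure_affine c t c0).

Lemma measurable_reflect : measurable_fun setT (-%R : measurableTypeR R -> measurableTypeR R).
Proof. by []. Qed.

Definition integrable_reflect :=
  integrable_scaling measurable_reflect ltr01 lebesgue_measure_reflect.
Definition Rintegral_reflect :=
  Rintegral_scaling measurable_reflect ltr01 lebesgue_measure_reflect.

Lemma integrable_shift (t : R) (f : R -> R) :
  mu.-integrable setT (EFin \o f) ->
  mu.-integrable setT (EFin \o (fun x => f (x + t))).
Proof.
move=> /(integrable_affine t ltr01); apply: eq_integrable => // x _ /=.
by rewrite mul1r.
Qed.

Lemma Rintegral_shift (t : R) (f : R -> R) :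
  mu.-integrable setT (EFin \o f) ->
  \int[mu]_x f (x + t) = \int[mu]_x f x.
Proof.
move=> fi; rewrite [RHS](Rintegral_affine t ltr01)// mul1r.
by apply: eq_Rintegral => x _ ; rewrite mul1r.
Qed.
End affine_reflect.

(** * Improper integrals of derivatives *)

Section real_valued_integrals.
Context d (T : measurableType d) (R : realType).
Variables (m : {measure set T -> \bar R}) (D : set T).
Hypothesis mD : measurable D.

Lemma dominated_Rintegrable (f g : T -> R) : measurable_fun D f ->
  (forall x, D x -> `|f x| <= g x) -> m.-integrable D (EFin \o g) ->
  m.-integrable D (EFin \o f).
Proof.
move=> mf fg; apply: le_integrable => //; first exact/measurable_EFinP.
by move=> x Dx /=; rewrite lee_fin (le_trans (fg x Dx))// ler_norm.
Qed.

Lemma Rintegral_dominated_cvg (f_ : nat -> T -> R) (f g : T -> R) :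
  (forall n, measurable_fun D (f_ n)) ->
  (forall x, D x -> f_ ^~ x @ \oo --> f x) ->
  (forall n x, D x -> `|f_ n x| <= g x) ->
  m.-integrable D (EFin \o g) ->
  \int[m]_(x in D) f_ n x @[n --> \oo] --> \int[m]_(x in D) f x.
Proof.
move=> mf ff fg ig.
have mf' n : measurable_fun D (EFin \o f_ n) by exact/measurable_EFinP.
have ff' x : D x -> (fun n => EFin \o f_ n) ^~ x @ \oo --> (EFin \o f) x.
  by move=> Dx; apply: cvg_EFin; [exact: nearW | exact: ff].
have [fi _ fcvg] : [/\ m.-integrable D (EFin \o f),
    \int[m]_(x in D) `|(EFin \o f_ n) x - (EFin \o f) x| @[n --> \oo] --> 0 &
    \int[m]_(x in D) (EFin \o f_ n) x @[n --> \oo] --> \int[m]_(x in D) (EFin \o f) x]%E.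
  apply: (dominated_convergence mD mf' _ _ ig).
  - by apply/measurable_EFinP; exact: (measurable_fun_cvg mf ff).
  - exact: aeW.
  - by apply: aeW => x n Dx; rewrite /= lee_fin; exact: fg.
by apply: fine_cvg; rewrite fineK//; exact: integrable_fin_num.
Qed.

End real_valued_integrals.

Section fundamental_theorem_exhaustion.
Context {R : realType}.
Local Notation mu := (@lebesgue_measure R).

(** The restrictions of [f] to the compact intervals are dominated by its absolute value, so the
    increments of [F] converge to the improper integral by dominated convergence. *)
Lemma Rintegral_FTC_exhaust (f F : R -> R) (D : set (measurableTypeR R)) (a b : nat -> R) (l : R) :
  measurable D -> (forall n, a n < b n) ->
  (forall n, `[a n, b n] `<=` D) ->
  (forall x, D x -> \forall n \near \oo, x \in `[a n, b n]) ->
  continuous f -> (forall x : R, is_derive x (1 : R) F (f x)) ->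
  mu.-integrable D (EFin \o f) ->
  F (b n) - F (a n) @[n --> \oo] --> l ->
  \int[mu]_(x in D) f x = l.
Proof.
move=> mD ab abD Dab cf dF fi Fl.
have mf : measurable_fun setT f by exact: continuous_measurable_fun.
suff : F (b n) - F (a n) @[n --> \oo] --> \int[mu]_(x in D) f x.
  by move=> h; rewrite -(cvg_lim _ h)//; exact: cvg_lim.
have -> : (fun n => F (b n) - F (a n)) =
    (fun n => \int[mu]_(x in D) (f \_ `[a n, b n]) x).
  apply/funext => n; rewrite -Rintegral_mkcondr (setIidr (abD n)) /Rintegral.
  rewrite (@continuous_FTC2 _ f F)//.
  - exact: continuous_subspaceT.
  - have cF x : {for x, continuous F}.
      by apply/differentiable_continuous/derivable1_diffP; case: (dF x).
    split=> [x _||]; first by case: (dF x).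
    + by apply: cvg_at_right_filter; exact: cF.
    + by apply: cvg_at_left_filter; exact: cF.
  - by move=> x _; rewrite derive1E; exact: derive_val.
apply: (@Rintegral_dominated_cvg _ _ _ mu D mD (fun n => f \_ `[a n, b n]) f (fun x => `|f x|)).
- move=> n; apply/measurable_restrict => //.
  exact: measurable_funTS.
- move=> x Dx; apply: cvg_near_cst; near=> n.
  by rewrite patchE mem_set//; near: n; exact: Dab.
- by move=> n x _; rewrite patchE; case: ifPn => // _; rewrite normr0.
- exact: integrable_norm.
Unshelve. all: by end_near. Qed.

Lemma Rintegral_FTC_T (f F : R -> R) (l1 l2 : R) :
  continuous f -> (forall x : R, is_derive x (1 : R) F (f x)) ->
  mu.-integrable setT (EFin \o f) ->
  F n%:R @[n --> \oo] --> l2 -> F (- n%:R) @[n --> \oo] --> l1 ->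
  \int[mu]_x f x = l2 - l1.
Proof.
move=> cf dF fi Fl2 Fl1.
apply: (@Rintegral_FTC_exhaust f F setT (fun n => - n.+1%:R) (fun n => n.+1%:R)) => //.
- by move=> n; rewrite gtrN// ltr0n.
- move=> x _; near=> n; rewrite in_itv/= -ler_norml.
  by rewrite (@le_trans _ _ n%:R)// ?ler_nat//; near: n; exact: nbhs_infty_ger.
- apply: cvgB; first by rewrite (cvg_shiftS (fun n => F n%:R)).
  by rewrite (cvg_shiftS (fun n => F (- n%:R))).
Unshelve. all: by end_near. Qed.

Lemma Rintegral_FTC_0y (f F : R -> R) (l : R) :
  continuous f -> (forall x : R, is_derive x (1 : R) F (f x)) ->
  mu.-integrable `[0, +oo[ (EFin \o f) ->
  F n%:R @[n --> \oo] --> l ->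
  \int[mu]_(x in `[0, +oo[) f x = l - F 0.
Proof.
move=> cf dF fi Fl.
apply: (@Rintegral_FTC_exhaust f F _ (fun n => 0) (fun n => n.+1%:R)) => //.
- by move=> n x /=; rewrite !in_itv/= andbT => /andP[].
- move=> x; rewrite /= in_itv/= andbT => x0; near=> n; rewrite in_itv/= x0/=.
  by rewrite (@le_trans _ _ n%:R)// ?ler_nat//; near: n; exact: nbhs_infty_ger.
- apply: cvgB; last exact: cvg_cst.
  by rewrite (cvg_shiftS (fun n => F n%:R)).
Unshelve. all: by end_near. Qed.

Lemma Rintegral_even (f : R -> R) : (forall x, f (- x) = f x) ->
  mu.-integrable setT (EFin \o f) ->
  \int[mu]_x f x = 2 * \int[mu]_(x in `[0, +oo[) f x.
Proof.
move=> ef fi.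
have fiD (D : set (measurableTypeR R)) : measurable D -> mu.-integrable D (EFin \o f).
  by move=> mD; apply: (integrableS measurableT).
have -> : [set: R] = `]-oo, 0[ `|` `[0, +oo[.
  by rewrite -setCitvr setUC setUv.
rewrite Rintegral_setU//=; last 2 first.
- by apply: (integrableS measurableT) => //; exact: measurableU.
- apply/disj_set2P/seteqP; split => // x [] /=; rewrite !in_itv/=.
  by move=> x0; rewrite andbT leNgt x0.
suff -> : \int[mu]_(x in `]-oo, 0[) f x = \int[mu]_(x in `[0, +oo[) f x.
  by rewrite mulr_natl mulr2n.
rewrite -[RHS]Rintegral_itv_obnd_cbnd; last exact: fiD.
rewrite Rintegral_mkcond (Rintegral_reflect (f := f \_ `]-oo, 0[)).
  rewrite mul1r [RHS]Rintegral_mkcond; apply: eq_Rintegral => x _.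
  by rewrite !patchE !mem_setE !in_itv/= oppr_lt0 andbT ef.
have mI : measurable (`]-oo, 0[%classic : set (measurableTypeR R)) by [].
by have /(integrable_mkcond _ mI).1 := fiD _ mI; rewrite restrict_EFin.
Qed.

End fundamental_theorem_exhaustion.

(** * Calculus rules for functions written out as abstractions *)

Section lambda_calculus_rules.
Context {R : realType}.
Implicit Types (f g : R -> R) (x a b : R).

Lemma is_derive_mulr f g x a b : is_derive x (1 : R) f a -> is_derive x (1 : R) g b ->
  is_derive x (1 : R) (fun y => f y * g y) (f x * b + g x * a).
Proof. by move=> df dg; apply: is_deriveM. Qed.

Lemma is_derive_addr f g x a b : is_derive x (1 : R) f a -> is_derive x (1 : R) g b ->
  is_derive x (1 : R) (fun y => f y + g y) (a + b).
Proof. by move=> df dg; apply: is_deriveD. Qed.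

Lemma is_derive_scale x a : is_derive x (1 : R) (fun y => a * y) a.
Proof.
have := is_deriveZ a (is_derive_id x (1 : R)).
by rewrite /GRing.scale/= mulr1.
Qed.

Lemma is_derive_expR_comp f x a : is_derive x (1 : R) f a ->
  is_derive x (1 : R) (fun y => expR (f y)) (expR (f x) * a).
Proof. by move=> df; apply: (@is_derive1_comp R expR f). Qed.

Lemma is_derive_cos_comp f x a : is_derive x (1 : R) f a ->
  is_derive x (1 : R) (fun y => cos (f y)) (- sin (f x) * a).
Proof. by move=> df; apply: (@is_derive1_comp R (@cos R) f). Qed.

Lemma is_derive_sin_comp f x a : is_derive x (1 : R) f a ->
  is_derive x (1 : R) (fun y => sin (f y)) (cos (f x) * a).
Proof. by move=> df; apply: (@is_derive1_comp R (@sin R) f). Qed.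

Lemma continuous_scale a : continuous (fun y : R => a * y).
Proof. by move=> x; apply: cvgM; [exact: cvg_cst|exact: cvg_id]. Qed.

Lemma continuous_mulr f g : continuous f -> continuous g ->
  continuous (fun y => f y * g y).
Proof. by move=> cf cg x; apply: cvgM; [exact: cf|exact: cg]. Qed.

Lemma continuous_compr f g : continuous f -> continuous g ->
  continuous (fun y => f (g y)).
Proof. by move=> cf cg x; apply: continuous_comp; [exact: cg|exact: cf]. Qed.

Lemma continuous_cos_scale a : continuous (fun y : R => cos (a * y)).
Proof. exact/continuous_compr/continuous_scale/continuous_cos. Qed.

Lemma continuous_sin_scale a : continuous (fun y : R => sin (a * y)).
Proof. exact/continuous_compr/continuous_scale/continuous_sin. Qed.

Lemma normr_cos a : `|cos a| <= 1 :> R.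
Proof. by rewrite ler_norml cos_geN1 cos_le1. Qed.

Lemma normr_sin a : `|sin a| <= 1 :> R.
Proof. by rewrite ler_norml sin_geN1 sin_le1. Qed.

End lambda_calculus_rules.

Section L1_lemmas.
Context {R : realType}.
Local Notation mu := (@lebesgue_measure R).

Implicit Types f g h : R -> R.

Definition L1 (f : R -> R) : Prop := mu.-integrable setT (EFin \o f).

Lemma L1_measurable f : L1 f -> measurable_fun setT f.
Proof. by move=> /integrableP[/measurable_EFinP]. Qed.

Lemma dominated_L1 f g : measurable_fun setT f ->
  (forall x, `|f x| <= g x) -> L1 g -> L1 f.
Proof.
move=> mf fg; apply: (@dominated_Rintegrable _ (measurableTypeR R) R mu setT _ f g) => //.
Qed.

Lemma L1_integrableS f (D : set (measurableTypeR R)) : measurable D -> L1 f ->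
  mu.-integrable D (EFin \o f).
Proof. by move=> mD fi; apply: (integrableS measurableT). Qed.

Lemma L1_eq f g : f =1 g -> L1 f -> L1 g.
Proof. by move=> /funext ->. Qed.

Lemma L1_scale c f : L1 f -> L1 (fun x => c * f x).
Proof.
by move=> /(@integrableZl _ (measurableTypeR R) R mu setT measurableT c).
Qed.

Lemma L1D f g : L1 f -> L1 g -> L1 (fun x => f x + g x).
Proof.
by move=> h1 h2; have := integrableD measurableT h1 h2.
Qed.

Lemma L1_norm f : L1 f -> L1 (fun x => `|f x|).
Proof. by move=> /integrable_norm. Qed.

Lemma L1_mul_bounded f h M : measurable_fun setT h -> (forall x, `|h x| <= M) ->
  L1 f -> L1 (fun x => f x * h x).
Proof.
move=> mh hM fi; apply: (@dominated_L1 _ (fun x => M * `|f x|)).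
- by apply: measurable_funM => //; exact: L1_measurable.
- by move=> x; rewrite normrM mulrC ler_wpM2r.
- exact/L1_scale/L1_norm.
Qed.

Lemma measurable_cos_scale x : measurable_fun setT (fun u : R => cos (x * u)).
Proof. by apply: continuous_measurable_fun; exact: continuous_cos_scale. Qed.

Lemma measurable_sin_scale x : measurable_fun setT (fun u : R => sin (x * u)).
Proof. by apply: continuous_measurable_fun; exact: continuous_sin_scale. Qed.

Lemma L1_cos f x : L1 f -> L1 (fun u => f u * cos (x * u)).
Proof.
by apply: (@L1_mul_bounded _ _ 1) => [|u]; [exact: measurable_cos_scale|exact: normr_cos].
Qed.

Lemma L1_sin f x : L1 f -> L1 (fun u => f u * sin (x * u)).
Proof.
by apply: (@L1_mul_bounded _ _ 1) => [|u]; [exact: measurable_sin_scale|exact: normr_sin].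
Qed.

Lemma le_normr_Rint f g : measurable_fun setT f -> (forall x, `|f x| <= g x) -> L1 g ->
  `|\int[mu]_x f x| <= \int[mu]_x g x.
Proof.
move=> mf fg gi; have fi := dominated_L1 mf fg gi.
apply: (le_trans (le_normr_Rintegral measurableT fi)).
by apply: (le_Rintegral measurableT (L1_norm fi) gi) => x _; exact: fg.
Qed.

Lemma continuous_parameter (f : R -> R -> R) (g : R -> R) :
  (forall l, measurable_fun setT (f l)) ->
  (forall u, continuous (f ^~ u)) ->
  (forall l u, `|f l u| <= g u) -> L1 g ->
  continuous (fun l => \int[mu]_u f l u).
Proof.
move=> mf cf fg gi a.
have /= h := @continuity_under_integral R _ (measurableTypeR R) mu f setT measurableT (a - 1) (a + 1)
   (fun l _ => dominated_L1 (mf l) (fg l) gi) _ g gi.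
apply: h.
- by apply: aeW => u _ x _; exact: cf.
- by move=> l _; apply: aeW => u _; exact: fg.
- by rewrite inE/= in_itv/=; apply/andP; split; lra.
Qed.

End L1_lemmas.

(** * Integrability and cosine transform of the two-sided exponential *)

Section exponential_decay.
Context {R : realType}.
Local Notation mu := (@lebesgue_measure R).
Implicit Types e x y : R.

Lemma cvgn_expRN e : 0 < e -> expR (- (e * n%:R)) @[n --> \oo] --> 0.
Proof.
move=> e0.
have : (expR (- e)) ^+ n @[n --> \oo] --> 0.
  by apply: cvg_expr; rewrite ger0_norm ?expR_ge0// expR_lt1 oppr_lt0.
by apply: cvg_trans; apply: near_eq_cvg; near=> n; rewrite -expRM_natr mulNr.
Unshelve. all: by end_near. Qed.

Lemma L1_oneDsqrV : L1 (fun x : R => (1 + x ^+ 2)^-1).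
Proof.
have cf : continuous (fun x : R => (1 + x ^+ 2)^-1) by exact: continuous_oneDsqrV.
apply/integrableP; split; first by apply/measurable_EFinP; exact: continuous_measurable_fun.
have p0 (x : R) : 0 <= (1 + x ^+ 2)^-1 by rewrite invr_ge0 addr_ge0// sqr_ge0.
under eq_integral do rewrite /= (ger0_norm (p0 _)).
rewrite ge0_symfun_integralT//; last by move=> x /=; rewrite sqrrN.
by rewrite -set_itvcy integral0y_oneDsqr -EFinM ltry.
Qed.

Lemma Rintegral_oneDsqrV : \int[mu]_x (1 + x ^+ 2)^-1 = pi :> R.
Proof.
rewrite Rintegral_even; [|by move=> x; rewrite sqrrN|exact: L1_oneDsqrV].
by rewrite /Rintegral integral0y_oneDsqr/=; field.
Qed.

(** Square [1 + x/2 <= expR (x/2)]. The bound reduces integrability of exponentials to that of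
    [(1 + x^2)^-1]. *)
Lemma expRN_le_oneDsqrV x : 0 <= x -> expR (- x) <= (1 + (2^-1 * x) ^+ 2)^-1.
Proof.
move=> x0; rewrite expRN lef_pV2 ?posrE ?expR_gt0//; last first.
  by rewrite ltr_pwDl// sqr_ge0.
have -> : expR x = expR (2^-1 * x) ^+ 2.
  by rewrite -expRM_natl; congr expR; field.
rewrite (@le_trans _ _ ((1 + 2^-1 * x) ^+ 2))//; first by nra.
by rewrite lerXn2r ?nnegrE ?expR_ge0 ?expR_ge1Dx//; nra.
Qed.

Lemma L1_expR_abs e : 0 < e -> L1 (fun x => expR (- (e * `|x|))).
Proof.
move=> e0; have e20 : 0 < 2^-1 * e by lra.
apply: dominated_L1 (integrable_affine 0 e20 L1_oneDsqrV).
- apply: continuous_measurable_fun; apply: continuous_compr; first exact: continuous_expR.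
  by move=> x; apply: cvgN; apply: cvgM; [exact: cvg_cst|exact: norm_continuous].
- move=> x; rewrite ger0_norm ?expR_ge0// (le_trans (expRN_le_oneDsqrV _))//.
    by rewrite mulr_ge0// ltW.
  rewrite le_eqVlt; apply/orP; left; apply/eqP; congr (1 + _)^-1.
  by rewrite addr0 mulrA !exprMn -normrX ger0_norm ?sqr_ge0.
Qed.

Lemma Rintegral_expR_abs_cos e y : 0 < e ->
  \int[mu]_x (expR (- (e * `|x|)) * cos (y * x)) = 2 * e / (e ^+ 2 + y ^+ 2).
Proof.
move=> e0; have ey0 : 0 < e ^+ 2 + y ^+ 2.
  by rewrite ltr_pwDl ?sqr_ge0// exprn_gt0.
have Lf := L1_cos y (L1_expR_abs e0).
rewrite Rintegral_even//; last by move=> x; rewrite normrN mulrN cosN.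
pose f x := expR (- e * x) * cos (y * x).
(* [F] is the real part of exp((-e + iy)x) / (-e + iy). *)
pose F x := expR (- e * x) * ((y / (e ^+ 2 + y ^+ 2)) * sin (y * x) +
               (- e / (e ^+ 2 + y ^+ 2)) * cos (y * x)).
rewrite (@eq_Rintegral _ _ _ mu `[0, +oo[ f); last first.
  by move=> x; rewrite inE/= in_itv/= andbT => x0; rewrite ger0_norm// /f mulNr.
have dF (x : R) : is_derive x (1 : R) F (f x).
  have dl a := is_derive_scale x a.
  have d1 := is_derive_expR_comp (dl (- e)).
  have d2 := is_derive_mulr (is_derive_cst (y / (e ^+ 2 + y ^+ 2)) x (1 : R)) (is_derive_sin_comp (dl y)).
  have d3 := is_derive_mulr (is_derive_cst (- e / (e ^+ 2 + y ^+ 2)) x (1 : R)) (is_derive_cos_comp (dl y)).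
  have d4 := is_derive_mulr d1 (is_derive_addr d2 d3).
  apply: (is_derive_eq d4); rewrite /f/=; field; lra.
rewrite (Rintegral_FTC_0y (l := 0) _ dF).
- by rewrite /F !mulr0 sin0 cos0 expR0 mulr0; field; lra.
- apply: continuous_mulr; last exact: continuous_cos_scale.
  exact/continuous_compr/continuous_scale/continuous_expR.
- have /= := L1_integrableS (measurable_itv `[0, +oo[) Lf.
  apply: eq_integrable => // x; rewrite inE/= in_itv/= andbT => x0.
  by rewrite /f ger0_norm// mulNr.
- pose K := `|y / (e ^+ 2 + y ^+ 2)| + `|- e / (e ^+ 2 + y ^+ 2)|.
  have h : expR (- (e * n%:R)) * K @[n --> \oo] --> 0.
    by rewrite -[0](mul0r K); apply: cvgM; [exact: cvgn_expRN|exact: cvg_cst].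
  apply: norm_cvg0; apply: (squeeze_cvgr _ (cvg_cst 0) h); near=> n.
  rewrite normr_ge0/= /F normrM mulNr ger0_norm ?expR_ge0// ler_wpM2l ?expR_ge0//.
  rewrite (le_trans (ler_normD _ _))// lerD// normrM ler_piMr//.
  + exact: normr_sin.
  + exact: normr_cos.
Unshelve. all: by end_near. Qed.

End exponential_decay.

(** * Fourier transforms and convolutions *)

Section Rintegral_Fubini.
Context d1 d2 (T1 : measurableType d1) (T2 : measurableType d2) (R : realType).
Variables (m1 : {sigma_finite_measure set T1 -> \bar R})
          (m2 : {sigma_finite_measure set T2 -> \bar R}).

Lemma prod_integrable (f : T1 * T2 -> R) (G : T1 -> R) :
  measurable_fun setT f ->
  (forall x, m2.-integrable setT (EFin \o (fun y => f (x, y)))) ->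
  (forall x, \int[m2]_y `|f (x, y)| <= G x) ->
  m1.-integrable setT (EFin \o G) ->
  (m1 \x m2)%E.-integrable setT (EFin \o f).
Proof.
move=> mf fi fG Gi; apply/integrable12ltyP; first exact/measurable_EFinP.
have Gy : (\int[m1]_x (G x)%:E < +oo)%E by exact: integrable_lty.
apply: le_lt_trans Gy; apply: ge0_le_integral => //.
- by move=> x _; exact: integral_ge0.
- apply: (measurable_fun_fubini_tonelli_F (m2 := m2) (abse \o (EFin \o f))).
  + by apply: measurableT_comp => //; exact/measurable_EFinP.
  + by move=> x; exact: abse_ge0.
- exact: measurable_int Gi.
- move=> x _; have /= -> : (\int[m2]_y `|(EFin \o f) (x, y)| = (\int[m2]_y `|f (x, y)|)%R%:E)%E.
    by rewrite /Rintegral fineK//; exact: integrable_fin_num (integrable_norm (fi x)).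
  by rewrite lee_fin.
Qed.

(** Every section, not just almost every one, is assumed integrable: all inner integrals are then
    finite, and the real-valued integrals agree with the extended ones. *)
Lemma Rintegral_Fubini (f : T1 * T2 -> R) :
  (m1 \x m2)%E.-integrable setT (EFin \o f) ->
  (forall x, m2.-integrable setT (EFin \o (fun y => f (x, y)))) ->
  (forall y, m1.-integrable setT (EFin \o (fun x => f (x, y)))) ->
  \int[m1]_x \int[m2]_y f (x, y) = \int[m2]_y \int[m1]_x f (x, y).
Proof.
move=> fi fi2 fi1; have := Fubini fi.
under eq_integral do rewrite -(fineK (integrable_fin_num _ (fi2 _)))//.
under [in X in _ = X -> _]eq_integral do rewrite -(fineK (integrable_fin_num _ (fi1 _)))//.
by move=> h; rewrite /Rintegral h.
Qed.

Lemma integrable_Rintegral2 (f : T1 * T2 -> R) :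
  (m1 \x m2)%E.-integrable setT (EFin \o f) ->
  (forall y, m1.-integrable setT (EFin \o (fun x => f (x, y)))) ->
  m2.-integrable setT (EFin \o (fun y => \int[m1]_x f (x, y))).
Proof.
move=> fi fi1; have mf := measurable_int _ fi.
have fE y : (\int[m1]_x (f (x, y))%:E = (\int[m1]_x f (x, y))%R%:E)%E.
  by rewrite /Rintegral fineK//; exact: integrable_fin_num (fi1 y).
apply/integrableP; split.
  have := measurable_fubini_G fi.
  by apply: eq_measurable_fun => y _ /=; rewrite -fE.
have := (integrable21ltyP m1 m2 mf).1 fi; apply: le_lt_trans.
apply: ge0_le_integral => //.
- apply/measurable_EFinP; apply: measurableT_comp => //; apply/measurable_EFinP.
  have := measurable_fubini_G fi.
  by apply: eq_measurable_fun => y _ /=; rewrite -fE.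
- apply: (measurable_fun_fubini_tonelli_G (m1 := m1) (abse \o (EFin \o f))).
  + exact: measurableT_comp.
  + by move=> x; exact: abse_ge0.
- move=> y _ /=; rewrite -abse_EFin -fE.
  by apply: le_abse_integral => //; exact: measurable_int (fi1 y).
Qed.

End Rintegral_Fubini.

Section fourier.
Context {R : realType}.
Local Notation mu := (@lebesgue_measure R).
Implicit Types (f g w : R -> R) (M N : R).

(** Real and imaginary parts of the Fourier transform with kernel exp(ixu), unnormalized; this sign
    is the one that matches Γ(a + ix). *)
Definition cosT f x := \int[mu]_u (f u * cos (x * u)).
Definition sinT f x := \int[mu]_u (f u * sin (x * u)).
Definition convolution f g y := \int[mu]_u (f u * g (y - u)).

Lemma continuous_cosT f : L1 f -> continuous (cosT f).
Proof.
move=> fi; apply: (@continuous_parameter _ (fun x u => f u * cos (x * u)) (fun u => `|f u|)).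
- by move=> x; apply: L1_measurable; exact: L1_cos.
- move=> u x; apply: cvgM; first exact: cvg_cst.
  by under eq_fun do rewrite mulrC; rewrite (mulrC x); exact: continuous_cos_scale.
- by move=> x u; rewrite normrM ler_piMr// normr_cos.
- exact: L1_norm.
Qed.

Lemma continuous_sinT f : L1 f -> continuous (sinT f).
Proof.
move=> fi; apply: (@continuous_parameter _ (fun x u => f u * sin (x * u)) (fun u => `|f u|)).
- by move=> x; apply: L1_measurable; exact: L1_sin.
- move=> u x; apply: cvgM; first exact: cvg_cst.
  by under eq_fun do rewrite mulrC; rewrite (mulrC x); exact: continuous_sin_scale.
- by move=> x u; rewrite normrM ler_piMr// normr_sin.
- exact: L1_norm.
Qed.

Lemma normr_cosT f x : L1 f -> `|cosT f x| <= \int[mu]_u `|f u|.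
Proof.
move=> fi; apply: le_normr_Rint; last exact: L1_norm.
  by apply: L1_measurable; exact: L1_cos.
by move=> u; rewrite normrM ler_piMr// normr_cos.
Qed.

Lemma normr_sinT f x : L1 f -> `|sinT f x| <= \int[mu]_u `|f u|.
Proof.
move=> fi; apply: le_normr_Rint; last exact: L1_norm.
  by apply: L1_measurable; exact: L1_sin.
by move=> u; rewrite normrM ler_piMr// normr_sin.
Qed.

Lemma cosTN f x : cosT f (- x) = cosT f x.
Proof. by apply: eq_Rintegral => u _; rewrite mulNr cosN. Qed.

Lemma sinTN f x : L1 f -> sinT f (- x) = - sinT f x.
Proof.
move=> /(L1_sin x) fi; rewrite /sinT -[RHS]mulN1r -RintegralZl//.
by apply: eq_Rintegral => u _; rewrite mulNr sinN mulrN mulN1r.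
Qed.

Lemma measurable_convolution_kernel f g w : measurable_fun setT f ->
  measurable_fun setT g -> measurable_fun setT w ->
  measurable_fun setT (fun p : measurableTypeR R * measurableTypeR R =>
     f p.1 * g (p.2 - p.1) * w p.2).
Proof.
move=> mf mg mw; apply: measurable_funM; last exact: measurableT_comp.
apply: measurable_funM; first exact: measurableT_comp.
apply: measurableT_comp => //.
by apply: measurable_funB.
Qed.

Lemma L1_convN g y : L1 g -> L1 (fun u => g (y - u)).
Proof.
move=> gi; apply: L1_eq (integrable_reflect (integrable_shift y gi)) => u /=.
by rewrite addrC.
Qed.

(** Fubini's theorem tested against a bounded weight: [w] equal to 1, to a cosine and to a sine
    gives the integral and the two transforms of a convolution. Boundedness of [g] makes the
    convolution integral converge at every point. *)
Lemma Rintegral_conv f g w M N : L1 f -> L1 g -> (forall u, `|g u| <= M) ->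
  measurable_fun setT w -> (forall u, `|w u| <= N) ->
  L1 (fun y => convolution f g y * w y) /\
  \int[mu]_y (convolution f g y * w y) = \int[mu]_u (f u * \int[mu]_v (g v * w (v + u))).
Proof.
move=> fi gi gM mw wN.
pose F (p : measurableTypeR R * measurableTypeR R) := f p.1 * g (p.2 - p.1) * w p.2.
have N0 : 0 <= N by rewrite (le_trans _ (wN 0)).
have gshift u : L1 (fun y => g (y - u)) by exact: integrable_shift.
have Fy u : L1 (fun y => F (u, y)).
  exact: (L1_mul_bounded mw wN (L1_scale (f u) (gshift u))).
have fgy y : L1 (fun u => f u * g (y - u)).
  by apply: (@L1_mul_bounded _ _ _ M) => //; apply: L1_measurable; exact: L1_convN.
have Fx y : L1 (fun u => F (u, y)).
  by apply: L1_eq (L1_scale (w y) (fgy y)) => u; rewrite mulrC.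
have mF : measurable_fun setT F.
  by apply: measurable_convolution_kernel => //; exact: L1_measurable.
have FI : (mu \x mu)%E.-integrable setT (EFin \o F).
  apply: (@prod_integrable _ _ (measurableTypeR R) (measurableTypeR R) R mu mu F (fun u => `|f u| * (N * \int[mu]_v `|g v|))) => //.
  - move=> u; rewrite -(Rintegral_shift (- u) (L1_norm gi)) mulrA -RintegralZl//; last first.
      exact: L1_norm (gshift u).
    apply: (@le_trans _ _ (`|\int[mu]_y `|F (u, y)| |)); first exact: ler_norm.
    apply: le_normr_Rint.
    + exact: L1_measurable (L1_norm (Fy u)).
    + move=> y; rewrite normr_id /F/= !normrM mulrAC ler_wpM2r//.
      by rewrite ler_wpM2l.
    + by apply: L1_scale; exact: L1_norm (gshift u).
  - apply: L1_eq (L1_scale (N * \int[mu]_v `|g v|) (L1_norm fi)) => u.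
    by rewrite mulrC.
have FE y : \int[mu]_u F (u, y) = convolution f g y * w y.
  by rewrite -RintegralZr//; exact: fgy.
split.
  apply: L1_eq FE _; exact: (integrable_Rintegral2 FI).
transitivity (\int[mu]_y \int[mu]_u F (u, y)); first by under eq_Rintegral do rewrite -FE.
rewrite -(Rintegral_Fubini FI)//; apply: eq_Rintegral => u _.
have gwi : L1 (fun y => g (y - u) * w y) by exact: L1_mul_bounded mw wN (gshift u).
transitivity (f u * \int[mu]_y (g (y - u) * w y)).
  by rewrite -RintegralZl//; apply: eq_Rintegral => y _; rewrite /F/= mulrA.
congr (_ * _); rewrite -(Rintegral_shift u gwi).
by apply: eq_Rintegral => v _; rewrite addrK.
Qed.

End fourier.

Section fourier_inversion.
Context {R : realType}.
Local Notation mu := (@lebesgue_measure R).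
Implicit Types (f g w : R -> R) (M N : R).

Let norm1 (u : R) : `|cst (1 : R) u| <= 1 :> R.
Proof. by rewrite normr1. Qed.

Lemma L1_conv f g M : L1 f -> L1 g -> (forall u, `|g u| <= M) -> L1 (convolution f g).
Proof.
move=> fi gi gM.
have [+ _] := Rintegral_conv fi gi gM (measurable_cst (1 : R)) norm1.
by apply: L1_eq => y; rewrite mulr1.
Qed.

Lemma Rintegral_convE f g M : L1 f -> L1 g -> (forall u, `|g u| <= M) ->
  \int[mu]_y convolution f g y = (\int[mu]_u f u) * \int[mu]_v g v.
Proof.
move=> fi gi gM.
have [_] := Rintegral_conv fi gi gM (measurable_cst (1 : R)) norm1.
under eq_Rintegral do rewrite mulr1.
move=> ->; rewrite -RintegralZr//; apply: eq_Rintegral => u _; congr (_ * _).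
by apply: eq_Rintegral => v _; rewrite mulr1.
Qed.

Lemma cosT_conv f g M x : L1 f -> L1 g -> (forall u, `|g u| <= M) ->
  cosT (convolution f g) x = cosT f x * cosT g x - sinT f x * sinT g x.
Proof.
move=> fi gi gM.
have [_] := Rintegral_conv fi gi gM (measurable_cos_scale x) (fun u => normr_cos _).
rewrite -[LHS]/(cosT (convolution f g) x) => ->.
have gc := L1_cos x gi; have gs := L1_sin x gi.
have fc := L1_cos x fi; have fs := L1_sin x fi.
transitivity (\int[mu]_u (f u * cos (x * u) * cosT g x - f u * sin (x * u) * sinT g x)).
  apply: eq_Rintegral => u _.
  rewrite -!mulrA -mulrBr; congr (_ * _).
  rewrite /cosT /sinT -!RintegralZl// -RintegralB//=; last 2 first.
  - exact: L1_scale.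
  - exact: L1_scale.
  by apply: eq_Rintegral => v _; rewrite mulrDr cosD; ring.
rewrite RintegralB//; last 2 first.
- by apply: L1_eq (L1_scale (cosT g x) fc) => u; rewrite mulrC.
- by apply: L1_eq (L1_scale (sinT g x) fs) => u; rewrite mulrC.
by rewrite !RintegralZr.
Qed.

Lemma sinT_conv f g M x : L1 f -> L1 g -> (forall u, `|g u| <= M) ->
  sinT (convolution f g) x = sinT f x * cosT g x + cosT f x * sinT g x.
Proof.
move=> fi gi gM.
have [_] := Rintegral_conv fi gi gM (measurable_sin_scale x) (fun u => normr_sin _).
rewrite -[LHS]/(sinT (convolution f g) x) => ->.
have gc := L1_cos x gi; have gs := L1_sin x gi.
have fc := L1_cos x fi; have fs := L1_sin x fi.
transitivity (\int[mu]_u (f u * sin (x * u) * cosT g x + f u * cos (x * u) * sinT g x)).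
  apply: eq_Rintegral => u _.
  rewrite -!mulrA -mulrDr; congr (_ * _).
  rewrite /cosT /sinT -!RintegralZl// -RintegralD//=; last 2 first.
  - exact: L1_scale.
  - exact: L1_scale.
  by apply: eq_Rintegral => v _; rewrite mulrDr sinD; ring.
rewrite RintegralD//; last 2 first.
- by apply: L1_eq (L1_scale (cosT g x) fs) => u; rewrite mulrC.
- by apply: L1_eq (L1_scale (sinT g x) fc) => u; rewrite mulrC.
by rewrite !RintegralZr.
Qed.

Lemma continuous_conv f g M : L1 f -> L1 g -> (forall u, `|g u| <= M) -> continuous g ->
  continuous (convolution f g).
Proof.
move=> fi gi gM cg.
apply: (@continuous_parameter _ (fun y u => f u * g (y - u)) (fun u => M * `|f u|)).
- move=> y; apply: measurable_funM; first exact: L1_measurable.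
  by apply: L1_measurable; exact: L1_convN.
- move=> u y; apply: cvgM; first exact: cvg_cst.
  apply: (@continuous_comp _ _ _ (fun y => y - u) g); last exact: cg.
  by apply: cvgB; [exact: cvg_id|exact: cvg_cst].
- by move=> y u; rewrite normrM mulrC ler_wpM2r.
- exact/L1_scale/L1_norm.
Qed.

Lemma normr_conv f g M y : L1 f -> L1 g -> (forall u, `|g u| <= M) ->
  `|convolution f g y| <= M * \int[mu]_u `|f u|.
Proof.
move=> fi gi gM; rewrite -RintegralZl//; last exact: L1_norm.
apply: le_normr_Rint; last exact/L1_scale/L1_norm.
- apply: measurable_funM; first exact: L1_measurable.
  by apply: L1_measurable; exact: L1_convN.
- by move=> u; rewrite normrM mulrC ler_wpM2r.
Qed.

(* Abel summation: the Fourier transform of [exp (- e |x|)] is the Poisson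
   kernel, an approximate identity as [e] tends to 0. *)
Lemma Rintegral_Abel f (e : R) : 0 < e -> L1 f ->
  \int[mu]_x (expR (- (e * `|x|)) * cosT f x) =
  \int[mu]_v (f (e * v) * (2 * (1 + v ^+ 2)^-1)).
Proof.
move=> e0 fi; have ei := L1_expR_abs e0.
have eM (x : R) : `|expR (- (e * `|x|))| <= 1.
  by rewrite ger0_norm ?expR_ge0// -expR0 ler_expR oppr_le0 mulr_ge0// ltW.
pose F (p : measurableTypeR R * measurableTypeR R) :=
  expR (- (e * `|p.1|)) * (f p.2 * cos (p.1 * p.2)).
have Fy (x : R) : L1 (fun y => F (x, y)) by exact: (L1_scale (expR (- (e * `|x|))) (L1_cos x fi)).
have FxE (y : R) : (fun x => f y * (expR (- (e * `|x|)) * cos (y * x))) =1 (fun x => F (x, y)).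
  by move=> x; rewrite /F/= mulrCA (mulrC x).
have Fx (y : R) : L1 (fun x => F (x, y)).
  exact: (L1_eq (FxE y) (L1_scale (f y) (L1_cos y ei))).
have mF : measurable_fun setT F.
  apply: measurable_funM; last apply: measurable_funM.
  - apply: (@measurableT_comp _ _ _ _ _ _ (fun x : R => expR (- (e * `|x|)))) => //.
    exact: L1_measurable ei.
  - by apply: measurableT_comp => //; exact: L1_measurable.
  - apply: measurableT_comp; last exact: measurable_funM.
    by apply: continuous_measurable_fun; exact: continuous_cos.
have FI : (mu \x mu)%E.-integrable setT (EFin \o F).
  apply: (@prod_integrable _ _ (measurableTypeR R) (measurableTypeR R) R mu mu F
    (fun x => (\int[mu]_y `|f y|) * expR (- (e * `|x|)))) => //; last exact: L1_scale.
  move=> x; rewrite mulrC -RintegralZl//; last exact: L1_norm.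
  apply: (@le_trans _ _ (`|\int[mu]_y `|F (x, y)| |)); first exact: ler_norm.
  apply: le_normr_Rint.
  + exact: L1_measurable (L1_norm (Fy x)).
  + move=> y; rewrite normr_id /F/= normrM ger0_norm ?expR_ge0// ler_wpM2l ?expR_ge0//.
    by rewrite normrM ler_piMr// normr_cos.
  + by apply: L1_scale; exact: L1_norm.
transitivity (\int[mu]_x \int[mu]_y F (x, y)).
  by apply: eq_Rintegral => x _; rewrite -RintegralZl//; exact: L1_cos.
rewrite (Rintegral_Fubini FI)//.
have KE (y : R) : \int[mu]_x F (x, y) = f y * (2 * e / (e ^+ 2 + y ^+ 2)).
  under eq_Rintegral do rewrite -FxE.
  by rewrite RintegralZl ?Rintegral_expR_abs_cos//; exact: L1_cos.
have fK : L1 (fun y => f y * (2 * e / (e ^+ 2 + y ^+ 2))).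
  by apply: L1_eq KE _; exact: (integrable_Rintegral2 FI).
under eq_Rintegral do rewrite KE.
(* The substitution y = e v turns the kernel 2e/(e² + y²) into the fixed kernel 2/(1 + v²), so that
   [e] survives only in the argument of [f]. *)
rewrite (Rintegral_affine 0 e0 fK) -RintegralZl; [|exact: measurableT|exact: (integrable_affine 0 e0 fK)].
apply: eq_Rintegral => v _; rewrite addr0 mulrCA; congr (_ * _).
have v0 : 0 < 1 + v ^+ 2 by rewrite ltr_pwDl// sqr_ge0.
have -> : e ^+ 2 + (e * v) ^+ 2 = e ^+ 2 * (1 + v ^+ 2) by ring.
by field; rewrite !gt_eqF.
Qed.

(** Both sides of the Abel formula pass to the limit along e = 1/(n+1) by dominated convergence, on
    the left under |[cosT f]|, on the right under 2M/(1 + v²). The factor 2π is the integral of 2/(1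
    + v²). The sine transform is odd, so inversion at 0 concerns the cosine part only. *)
Lemma fourier_inversion0 f M : L1 f -> continuous f -> (forall u, `|f u| <= M) ->
  L1 (cosT f) -> \int[mu]_x cosT f x = 2 * pi * f 0.
Proof.
move=> fi cf fM ci; pose e (n : nat) : R := n.+1%:R^-1.
have e0 n : 0 < e n by rewrite invr_gt0 ltr0n.
have eto0 : e n @[n --> \oo] --> (0 : R) by exact: cvge_harmonic || exact: cvg_harmonic.
have cvl : \int[mu]_x (expR (- (e n * `|x|)) * cosT f x) @[n --> \oo] -->
    \int[mu]_x cosT f x.
  apply: (@Rintegral_dominated_cvg _ (measurableTypeR R) R mu setT measurableT
     (fun n x => expR (- (e n * `|x|)) * cosT f x) (cosT f) (fun x => `|cosT f x|)).
  - move=> n; apply: measurable_funM; first exact: L1_measurable (L1_expR_abs (e0 n)).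
    exact: L1_measurable.
  - move=> x _; rewrite -[X in _ --> X]mul1r; apply: cvgM; last exact: cvg_cst.
    rewrite -[X in _ --> X]expR0.
    apply: (@cvg_comp _ _ _ (fun n => - (e n * `|x|)) expR _ (nbhs (0 : R))); last exact: continuous_expR.
    rewrite -oppr0; apply: cvgN; rewrite -(mul0r `|x|).
    by apply: cvgM => //; exact: cvg_cst.
  - move=> n x _; rewrite normrM ler_piMl// ger0_norm ?expR_ge0//.
    by rewrite -expR0 ler_expR oppr_le0 mulr_ge0// ltW.
  - exact: L1_norm.
have cvr : \int[mu]_v (f (e n * v) * (2 * (1 + v ^+ 2)^-1)) @[n --> \oo] -->
    \int[mu]_v (f 0 * (2 * (1 + v ^+ 2)^-1)).
  have p0 v : 0 <= (2 * (1 + v ^+ 2)^-1) :> R.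
    by rewrite mulr_ge0// invr_ge0 addr_ge0// sqr_ge0.
  have Li : L1 (fun v : R => 2 * (1 + v ^+ 2)^-1) by exact/L1_scale/L1_oneDsqrV.
  apply: (@Rintegral_dominated_cvg _ (measurableTypeR R) R mu setT measurableT
     (fun n v => f (e n * v) * (2 * (1 + v ^+ 2)^-1)) (fun v => f 0 * (2 * (1 + v ^+ 2)^-1))
     (fun v => M * (2 * (1 + v ^+ 2)^-1))).
  - move=> n; apply: measurable_funM; last exact: L1_measurable Li.
    by apply: continuous_measurable_fun; apply: continuous_compr; [exact: cf|exact: continuous_scale].
  - move=> v _; apply: cvgM; last exact: cvg_cst.
    apply: (@cvg_comp _ _ _ (fun n => e n * v) f _ (nbhs (0 : R))); last exact: cf.
    by rewrite -(mul0r v); apply: cvgM => //; exact: cvg_cst.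
  - by move=> n v _; rewrite normrM (ger0_norm (p0 v)) ler_wpM2r.
  - exact: L1_scale.
rewrite -(cvg_lim _ cvl)//.
under [in LHS]eq_fun do rewrite Rintegral_Abel//.
rewrite (cvg_lim _ cvr)//.
under eq_Rintegral do rewrite mulrA.
by rewrite RintegralZl ?Rintegral_oneDsqrV; [ring|by []|exact: L1_oneDsqrV].
Qed.

End fourier_inversion.

(** * The Gamma function as a Fourier transform *)

Section expR_substitution.
Context {R : realType}.
Local Notation mu := (@lebesgue_measure R).

Lemma derive1_expR_fun : (expR : R -> R)^`()%classic = expR.
Proof. by apply/funext => x; rewrite derive1E; exact: derive_val. Qed.

(** The substitution is made on [exp(-n), exp n], and both sides increase to the full integrals by
    monotone convergence; this is where the sign of [h] is used. *)
Lemma ge0_integral_expR (h : R -> R) :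
  {in `]0, +oo[, continuous h} -> (forall t, 0 < t -> 0 <= h t) ->
  (\int[mu]_(t in `]0%R, +oo[) (h t)%:E = \int[mu]_u (h (expR u) * expR u)%:E)%E.
Proof.
move=> ch h0.
pose A (n : nat) : set (measurableTypeR R) := `[expR (- n%:R), expR n%:R]%classic.
pose B (n : nat) : set (measurableTypeR R) := `[- n%:R, n%:R]%classic.
have AE : \bigcup_n A n = `]0, +oo[%classic.
  apply/seteqP; split => t /=.
    by move=> [n _]; rewrite /A/= !in_itv/= andbT => /andP[+ _]; apply: lt_le_trans; exact: expR_gt0.
  rewrite in_itv/= andbT => t0; exists (Num.truncn `|ln t|).+1 => //.
  have /ltW := real_truncnS_gt (normr_real (ln t)); rewrite ler_norml => /andP[h1 h2].
  rewrite /A/= in_itv/=; apply/andP; split.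
    by rewrite -[leRHS]lnK ?posrE// ler_expR.
  by rewrite -[leLHS]lnK ?posrE// ler_expR.
have BE : \bigcup_n B n = [set: R].
  apply/seteqP; split => // x _; exists (Num.truncn `|x|).+1 => //.
  have /ltW := real_truncnS_gt (normr_real x); rewrite ler_norml => /andP[h1 h2].
  by rewrite /B/= in_itv/= h1.
have ndA : nondecreasing_seq A.
  move=> n m nm; apply/subsetPset => t; rewrite /A/= !in_itv/= => /andP[h1 h2].
  apply/andP; split; first by apply: le_trans h1; rewrite ler_expR lerN2 ler_nat.
  by apply: (le_trans h2); rewrite ler_expR ler_nat.
have ndB : nondecreasing_seq B.
  move=> n m nm; apply/subsetPset => t; rewrite /B/= !in_itv/= => /andP[h1 h2].
  apply/andP; split; first by apply: le_trans h1; rewrite lerN2 ler_nat.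
  by apply: (le_trans h2); rewrite ler_nat.
have chA n : {within A n, continuous h}.
  apply: continuous_in_subspaceT => t; rewrite inE /A/= => tA; apply: ch.
  move: tA; rewrite !in_itv/= andbT => /andP[+ _]; apply: lt_le_trans; exact: expR_gt0.
have cH : continuous (fun u => h (expR u) * expR u).
  move=> u; apply: cvgM; last exact: continuous_expR.
  apply: continuous_comp; first exact: continuous_expR.
  by apply: ch; rewrite in_itv/= expR_gt0.
have cvA : (\int[mu]_(x in A n) (h x)%:E @[n --> \oo] --> \int[mu]_(x in \bigcup_n A n) (h x)%:E)%E.
  apply: ge0_nondecreasing_set_cvg_integral => //.
  - by move=> n; exact: measurable_itv.
  - move=> n; apply/measurable_EFinP; apply: subspace_continuous_measurable_fun => //.
    exact: measurable_itv.
  - move=> n x; rewrite /A/= in_itv/= lee_fin => /andP[+ _] => hx; apply: h0.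
    by apply: lt_le_trans hx; exact: expR_gt0.
have cvB : (\int[mu]_(u in B n) (h (expR u) * expR u)%:E @[n --> \oo] -->
    \int[mu]_(u in \bigcup_n B n) (h (expR u) * expR u)%:E)%E.
  apply: ge0_nondecreasing_set_cvg_integral => //.
  - by move=> n; exact: measurable_itv.
  - move=> n; apply/measurable_EFinP; apply: measurable_funTS.
    exact: continuous_measurable_fun.
  - by move=> n x _; rewrite lee_fin mulr_ge0 ?expR_ge0// h0// expR_gt0.
rewrite -AE -[in RHS]BE -(cvg_lim _ cvA)// -(cvg_lim _ cvB)//.
congr (limn _); apply/funext => n.
rewrite /A /B (@integration_by_substitution_increasing _ expR h).
- by rewrite derive1_expR_fun.
- by rewrite (@le_trans _ _ 0)// oppr_le0.
- by move=> x y _ _; rewrite ltr_expR.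
- by rewrite derive1_expR_fun => x _; exact: continuous_expR.
- rewrite derive1_expR_fun; apply/cvg_ex; eexists; apply: cvg_at_right_filter.
  exact: continuous_expR.
- rewrite derive1_expR_fun; apply/cvg_ex; eexists; apply: cvg_at_left_filter.
  exact: continuous_expR.
- split.
  + by move=> x _; exact: derivable_expR.
  + by apply: cvg_at_right_filter; exact: continuous_expR.
  + by apply: cvg_at_left_filter; exact: continuous_expR.
- exact: chA.
Qed.

(** The signed case follows by writing [h] as [(|h| + h) - |h|], a difference of nonnegative
    functions. Integrability on the half-line is obtained from the substitution for [|h|]. *)
Lemma Rintegral_expR (h : R -> R) :
  {in `]0, +oo[, continuous h} -> L1 (fun u => h (expR u) * expR u) ->
  \int[mu]_(t in `]0, +oo[) h t = \int[mu]_u (h (expR u) * expR u).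
Proof.
move=> ch Hi.
have cn : {in `]0, +oo[, continuous (fun t => `|h t|)}.
  by move=> t t0; apply: continuous_comp; [exact: ch|exact: norm_continuous].
have cp : {in `]0, +oo[, continuous (fun t => `|h t| + h t)}.
  by move=> t t0; apply: cvgD; [exact: cn|exact: ch].
have nE := ge0_integral_expR cn (fun t _ => normr_ge0 (h t)).
have pE : (\int[mu]_(t in `]0%R, +oo[) (`|h t| + h t)%:E =
    \int[mu]_u ((`|h (expR u)| + h (expR u)) * expR u)%:E)%E.
  by apply: ge0_integral_expR => // t _; rewrite -lerBlDr sub0r ler_normr lexx orbT.
have Hn : L1 (fun u => `|h (expR u)| * expR u).
  apply: L1_eq (L1_norm Hi) => u.
  by rewrite normrM (ger0_norm (expR_ge0 u)).
have mI : measurable (`]0, +oo[%classic : set (measurableTypeR R)) by exact: measurable_itv.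
have mh : measurable_fun (`]0, +oo[%classic : set (measurableTypeR R)) h.
  apply: open_continuous_measurable_fun; first exact: interval_open.
  by move=> t; rewrite inE => t0; exact: ch.
have ni : mu.-integrable `]0, +oo[ (EFin \o (fun t => `|h t|)).
  apply/integrableP; split.
    by apply/measurable_EFinP; exact: measurableT_comp.
  under eq_integral do rewrite /= normr_id.
  rewrite nE; exact: integrable_lty Hn.
have hi : mu.-integrable `]0, +oo[ (EFin \o h).
  by apply: (dominated_Rintegrable mI mh _ ni) => t _.
rewrite (_ : \int[mu]_(t in `]0, +oo[) h t =
  \int[mu]_(t in `]0, +oo[) (`|h t| + h t) - \int[mu]_(t in `]0, +oo[) `|h t|); last first.
  by rewrite RintegralD// addrAC subrr add0r.
rewrite /Rintegral nE pE -!/(Rintegral _ _ _).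
rewrite -RintegralB//; first by apply: eq_Rintegral => u _; ring.
by apply: L1_eq (L1D Hn Hi) => u; rewrite mulrDl.
Qed.

End expR_substitution.

Section exponential_decay_predicate.
Context {R : realType}.
Implicit Types (f g : R -> R) (C d : R).

Definition expdecay f :=
  exists C d, 0 < d /\ forall u, `|f u| <= C * expR (- (d * `|u|)).

Lemma expdecay_L1 f : measurable_fun setT f -> expdecay f -> L1 f.
Proof.
move=> mf [C [d [d0 fC]]].
exact: (dominated_L1 mf fC (L1_scale C (L1_expR_abs d0))).
Qed.

Lemma expdecay_cvg f (s : nat -> R) : expdecay f -> (forall n, `|s n| = n%:R) ->
  f (s n) @[n --> \oo] --> 0.
Proof.
move=> [C [d [d0 fC]]] sn; apply: norm_cvg0.
have h : C * expR (- (d * n%:R)) @[n --> \oo] --> 0.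
  by rewrite -[0](mulr0 C); apply: cvgM; [exact: cvg_cst|exact: cvgn_expRN].
apply: (squeeze_cvgr _ (cvg_cst 0) h); near=> n.
by rewrite normr_ge0/= -(sn n) fC.
Unshelve. all: by end_near. Qed.

Lemma expdecay_mul_bounded f g : expdecay f -> (forall u, `|g u| <= 1) ->
  expdecay (fun u => f u * g u).
Proof.
move=> [C [d [d0 fC]]] g1; exists C, d; split => // u.
by rewrite normrM; apply: le_trans (fC u); rewrite ler_piMr.
Qed.

End exponential_decay_predicate.

Section gamma_kernel.
Context {R : realType}.
Local Notation mu := (@lebesgue_measure R).
Implicit Types (a x u : R).

(* The substitution [t = exp u] turns Euler's integral for [Gamma (a + i x)]
   into the Fourier transform of [gker a] at [x]. *)
Definition gker a u := expR (a * u - expR u).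

Lemma gker_gt0 a u : 0 < gker a u. Proof. exact: expR_gt0. Qed.

Lemma gkerS a u : gker (a + 1) u = gker a u * expR u.
Proof. by rewrite /gker -expRD; congr expR; ring. Qed.

Lemma continuous_gker a : continuous (gker a).
Proof.
apply: continuous_compr; first exact: continuous_expR.
by move=> u; apply: cvgB; [exact: continuous_scale|exact: continuous_expR].
Qed.

Lemma is_derive_gker a u : is_derive u (1 : R) (gker a) (a * gker a u - gker (a + 1) u).
Proof.
have d1 : is_derive u (1 : R) (fun u => a * u - expR u) (a - expR u).
  exact: (is_deriveB (is_derive_scale u a) (is_derive_expR u)).
apply: (is_derive_eq (is_derive_expR_comp d1)).
by rewrite gkerS /gker; ring.
Qed.

Lemma expdecay_gker a : 0 < a -> expdecay (gker a).
Proof.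
move=> a0.
have a1 : 0 < a + 1 by lra.
(* For u >= 0, the exponential lies above its tangent at [c], where the slope is a + 1; hence a u -
   exp u <= -u - (a+1)(1-c). For u < 0, the term exp u is simply dropped and the rate is a. The
   minimum of a and 1 serves both sides. *)
pose c := ln (a + 1); pose K := expR (- ((a + 1) * (1 - c))).
have eK : expR c = a + 1 by rewrite lnK ?posrE.
exists (1 + K), (Num.min a 1); split; first by rewrite lt_min a0 ltr01.
move=> u; rewrite ger0_norm ?(ltW (gker_gt0 _ _))//.
have K0 : 0 < K by exact: expR_gt0.
have [u0|u0] := leP 0 u.
- rewrite ger0_norm//.
  have eu : (a + 1) * (1 + (u - c)) <= expR u.
    have -> : expR u = expR c * expR (u - c) by rewrite -expRD; congr expR; ring.
    by rewrite eK; apply: ler_wpM2l; [exact: ltW|exact: expR_ge1Dx].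
  apply: (@le_trans _ _ (K * expR (- u))).
    rewrite /K /gker -expRD ler_expR; lra.
  apply: ler_pM; [exact: ltW|exact: expR_ge0|by rewrite lerDr|].
  by rewrite ler_expR lerN2 ler_piMl// ge_min lexx orbT.
- rewrite ltr0_norm// mulrN opprK.
  apply: (@le_trans _ _ (expR (Num.min a 1 * u))).
    rewrite /gker ler_expR; have := expR_gt0 u.
    have : a * u <= Num.min a 1 * u by apply: ler_wnM2r; [exact: ltW|rewrite ge_min lexx].
    lra.
  by apply: ler_peMl; [exact: expR_ge0|rewrite lerDl ltW].
Qed.

Lemma L1_gker a : 0 < a -> L1 (gker a).
Proof.
move=> a0; apply: expdecay_L1; last exact: expdecay_gker.
by apply: continuous_measurable_fun; exact: continuous_gker.
Qed.

Definition gammaR a : R := \int[mu]_u gker a u.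

(** Real part of Γ(z+1) = z Γ(z) at z = a + ix. It is an integration by parts: the derivative of
    [gker a u * cos (x * u)] has integral 0 because the function decays at both ends. *)
Lemma cosT_gkerS a x : 0 < a ->
  cosT (gker (a + 1)) x = a * cosT (gker a) x - x * sinT (gker a) x.
Proof.
move=> a0; have a1 : 0 < a + 1 by lra.
have ga := L1_gker a0; have ga1 := L1_gker a1.
pose f u := (a * (gker a u * cos (x * u)) - x * (gker a u * sin (x * u))) - gker (a + 1) u * cos (x * u).
have Lac := L1_scale a (L1_cos x ga); have Las := L1_scale x (L1_sin x ga).
have L1c := L1_cos x ga1.
have fE : \int[mu]_u f u = a * cosT (gker a) x - x * sinT (gker a) x - cosT (gker (a + 1)) x.
  rewrite /f RintegralB//; last first.
    by have := L1D Lac (L1_scale (-1) Las); apply: L1_eq => u; rewrite mulN1r.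
  by rewrite RintegralB// !RintegralZl//; [exact: L1_sin|exact: L1_cos].
suff f0 : \int[mu]_u f u = 0 by move: fE; rewrite f0 => h; lra.
pose F u := gker a u * cos (x * u).
have dF u : is_derive u (1 : R) F (f u).
  apply: (is_derive_eq (is_derive_mulr (is_derive_gker a u) (is_derive_cos_comp (is_derive_scale u x)))).
  by rewrite /f; ring.
rewrite -[RHS]subr0; apply: (Rintegral_FTC_T _ dF).
- move=> u; rewrite /f; apply: cvgB; [apply: cvgB|].
  + by apply: cvgM; [exact: cvg_cst|apply: cvgM; [exact: continuous_gker|exact: continuous_cos_scale]].
  + by apply: cvgM; [exact: cvg_cst|apply: cvgM; [exact: continuous_gker|exact: continuous_sin_scale]].
  + by apply: cvgM; [exact: continuous_gker|exact: continuous_cos_scale].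
- have := L1D (L1D Lac (L1_scale (-1) Las)) (L1_scale (-1) L1c).
  by apply: L1_eq => u; rewrite !mulN1r.
- apply: (@expdecay_cvg _ _ (fun n => n%:R)) => [|n]; last by rewrite ger0_norm.
  by apply: expdecay_mul_bounded; [exact: expdecay_gker|move=> u; exact: normr_cos].
- apply: (@expdecay_cvg _ _ (fun n => - n%:R)) => [|n]; last by rewrite normrN ger0_norm.
  by apply: expdecay_mul_bounded; [exact: expdecay_gker|move=> u; exact: normr_cos].
Qed.

(** Imaginary part of the same functional equation. *)
Lemma sinT_gkerS a x : 0 < a ->
  sinT (gker (a + 1)) x = a * sinT (gker a) x + x * cosT (gker a) x.
Proof.
move=> a0; have a1 : 0 < a + 1 by lra.
have ga := L1_gker a0; have ga1 := L1_gker a1.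
pose f u := (a * (gker a u * sin (x * u)) + x * (gker a u * cos (x * u))) - gker (a + 1) u * sin (x * u).
have Lac := L1_scale x (L1_cos x ga); have Las := L1_scale a (L1_sin x ga).
have L1c := L1_sin x ga1.
have fE : \int[mu]_u f u = a * sinT (gker a) x + x * cosT (gker a) x - sinT (gker (a + 1)) x.
  rewrite /f RintegralB//; last exact: (L1D Las Lac).
  by rewrite RintegralD// !RintegralZl//; [exact: L1_cos|exact: L1_sin].
suff f0 : \int[mu]_u f u = 0 by move: fE; rewrite f0 => h; lra.
pose F u := gker a u * sin (x * u).
have dF u : is_derive u (1 : R) F (f u).
  apply: (is_derive_eq (is_derive_mulr (is_derive_gker a u) (is_derive_sin_comp (is_derive_scale u x)))).
  by rewrite /f; ring.
rewrite -[RHS]subr0; apply: (Rintegral_FTC_T _ dF).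
- move=> u; rewrite /f; apply: cvgB; [apply: cvgD|].
  + by apply: cvgM; [exact: cvg_cst|apply: cvgM; [exact: continuous_gker|exact: continuous_sin_scale]].
  + by apply: cvgM; [exact: cvg_cst|apply: cvgM; [exact: continuous_gker|exact: continuous_cos_scale]].
  + by apply: cvgM; [exact: continuous_gker|exact: continuous_sin_scale].
- have := L1D (L1D Las Lac) (L1_scale (-1) L1c).
  by apply: L1_eq => u; rewrite !mulN1r.
- apply: (@expdecay_cvg _ _ (fun n => n%:R)) => [|n]; last by rewrite ger0_norm.
  by apply: expdecay_mul_bounded; [exact: expdecay_gker|move=> u; exact: normr_sin].
- apply: (@expdecay_cvg _ _ (fun n => - n%:R)) => [|n]; last by rewrite normrN ger0_norm.
  by apply: expdecay_mul_bounded; [exact: expdecay_gker|move=> u; exact: normr_sin].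
Qed.

Local Open Scope complex_scope.

Lemma Gamma_gker a x : 0 < a ->
  Gamma (a +i* x) = cosT (gker a) x +i* sinT (gker a) x.
Proof.
move=> a0; rewrite /Gamma /= a0 addr0 /poch big_ord0 divr1 /euler_integral /cintegral.
have ga := L1_gker a0.
have powE t : 0 < t -> t `^ (a - 1) = expR ((a - 1) * ln t).
  by move=> t0; rewrite /powR gt_eqF.
(* Both parts of Euler's integral are covered by one substitution, with [w] the cosine or the
   sine. *)
have hE (w : R -> R) : continuous w -> L1 (fun u => gker a u * w (x * u)) ->
    \int[mu]_(t in `]0, +oo[) (expR (- t) * expR ((a - 1) * ln t) * w (x * ln t)) =
    \int[mu]_u (gker a u * w (x * u)).
  move=> cw Lw.
  have HE u : gker a u * w (x * u) = expR (- expR u) * expR ((a - 1) * ln (expR u)) * w (x * ln (expR u)) * expR u.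
    rewrite expRK [RHS]mulrAC -!expRD; congr (expR _ * _); ring.
  rewrite Rintegral_expR.
  - by apply: eq_Rintegral => u _; rewrite HE.
  - move=> t; rewrite in_itv/= andbT => t0.
    have cl : {for t, continuous (@ln R)} by exact: continuous_ln.
    apply: cvgM; [apply: cvgM|].
    + apply: (@continuous_comp _ _ _ -%R expR); [exact: opp_continuous|exact: continuous_expR].
    + apply: (@continuous_comp _ _ _ (fun t => (a - 1) * ln t) expR); last exact: continuous_expR.
      by apply: cvgM; [exact: cvg_cst|exact: cl].
    + apply: (@continuous_comp _ _ _ (fun t => x * ln t) w); last exact: cw.
      by apply: cvgM; [exact: cvg_cst|exact: cl].
  - by apply: L1_eq Lw => u; exact: HE.
congr (_ +i* _).
- rewrite /cosT -(hE (@cos R))//; [|exact: continuous_cos|exact: L1_cos].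
  apply: eq_Rintegral => t; rewrite inE/= in_itv/= andbT => t0.
  by rewrite /rpow /= powE// !(mul0r, mulr0, subr0, addr0); ring.
- rewrite /sinT -(hE (@sin R))//; [|exact: continuous_sin|exact: L1_sin].
  apply: eq_Rintegral => t; rewrite inE/= in_itv/= andbT => t0.
  by rewrite /rpow /= powE// !(mul0r, mulr0, subr0, addr0); ring.
Qed.

End gamma_kernel.

(** * Barnes' first lemma *)

Section barnes_real.
Context {R : realType}.
Local Notation mu := (@lebesgue_measure R).
Implicit Types (f g : R -> R) (a b c d x y u : R).

Lemma expdecay_bounded f : expdecay f -> exists M, forall u, `|f u| <= M.
Proof.
move=> [C [d [d0 fC]]]; exists C => u; rewrite (le_trans (fC u))// ler_piMr//.
  by have := fC 0; rewrite normr0 mulr0 oppr0 expR0 mulr1; apply: le_trans.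
by rewrite -[leRHS]expR0 ler_expR oppr_le0 mulr_ge0// ltW.
Qed.

Lemma cosT_reflect f x : L1 f -> cosT (fun u => f (- u)) x = cosT f x.
Proof.
move=> fi; rewrite /cosT [RHS](Rintegral_reflect (f := fun u => f u * cos (x * u))); last exact: L1_cos.
by rewrite mul1r; apply: eq_Rintegral => u _; rewrite mulrN cosN.
Qed.

Lemma sinT_reflect f x : L1 f -> sinT (fun u => f (- u)) x = - sinT f x.
Proof.
move=> fi; rewrite -sinTN// /sinT.
rewrite [RHS](Rintegral_reflect (f := fun u => f u * sin (- x * u))); last exact: L1_sin.
by rewrite mul1r; apply: eq_Rintegral => u _; rewrite mulrNN.
Qed.

Lemma Rintegral_odd f : L1 f -> (forall x, f (- x) = - f x) -> \int[mu]_x f x = 0.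
Proof.
move=> fi fN; have := Rintegral_reflect fi; rewrite mul1r.
under [in X in _ = X -> _]eq_Rintegral do rewrite fN -mulN1r.
by rewrite RintegralZl//; lra.
Qed.

Lemma gammaR_gt0 a : 0 < a -> 0 < gammaR a.
Proof.
move=> a0; pose D : set (measurableTypeR R) := `[0, 1]%classic.
have mD : measurable D by exact: measurable_itv.
have Dge u : D u -> expR (- expR 1) <= gker a u.
  rewrite /D/= in_itv/= => /andP[u0 u1]; rewrite /gker ler_expR.
  have : expR u <= expR 1 by rewrite ler_expR.
  have : 0 <= a * u by rewrite mulr_ge0// ltW.
  lra.
apply: (@lt_le_trans _ _ (\int[mu]_(u in D) gker a u)).
  apply: (@lt_le_trans _ _ (\int[mu]_(u in D) expR (- expR 1))).
    rewrite Rintegral_cst//= /D lebesgue_measure_itv/= lte_fin ltr01.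
    by rewrite -EFinB/= subr0 mulr1 expR_gt0.
  apply: le_Rintegral => //; last exact: (L1_integrableS mD (L1_gker a0)).
  apply: (dominated_Rintegrable mD _ _ (L1_integrableS mD (L1_gker a0))).
  - exact: measurable_cst.
  - by move=> u Du; rewrite ger0_norm ?expR_ge0//; exact: Dge.
rewrite /gammaR /Rintegral fine_le//.
- exact: integrable_fin_num (L1_integrableS mD (L1_gker a0)).
- exact: integrable_fin_num (L1_gker a0).
- apply: ge0_subset_integral => //.
  + by apply/measurable_EFinP; exact: L1_measurable (L1_gker a0).
  + by move=> u _; rewrite lee_fin ltW// gker_gt0.
Qed.

Lemma normr_cosT_gker a x : 0 < a -> `|cosT (gker a) x| <= gammaR a.
Proof.
move=> a0; apply: (le_trans (normr_cosT x (L1_gker a0))).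
by under eq_Rintegral do rewrite ger0_norm ?(ltW (gker_gt0 _ _))//.
Qed.

Lemma normr_sinT_gker a x : 0 < a -> `|sinT (gker a) x| <= gammaR a.
Proof.
move=> a0; apply: (le_trans (normr_sinT x (L1_gker a0))).
by under eq_Rintegral do rewrite ger0_norm ?(ltW (gker_gt0 _ _))//.
Qed.

Lemma gammaRE a : gammaR a = cosT (gker a) 0.
Proof. by apply: eq_Rintegral => u _; rewrite mul0r cos0 mulr1. Qed.

Lemma gammaRS a : 0 < a -> gammaR (a + 1) = a * gammaR a.
Proof. by move=> a0; rewrite !gammaRE cosT_gkerS// mul0r subr0. Qed.

(** The functional equation, solved for the term carrying the factor [x], bounds it by Gamma values
    on the real axis. Each Gamma factor thus decays at least like 1/|x| along a vertical line. *)
Lemma normr_mul_cosT_gker a x : 0 < a -> `|x * cosT (gker a) x| <= 2 * gammaR (a + 1).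
Proof.
move=> a0; have a1 : 0 < a + 1 by lra.
have -> : x * cosT (gker a) x = sinT (gker (a + 1)) x - a * sinT (gker a) x.
  by rewrite sinT_gkerS//; ring.
rewrite (le_trans (ler_normB _ _))// mulr_natl mulr2n lerD//; first exact: normr_sinT_gker.
by rewrite normrM (gtr0_norm a0) gammaRS// ler_wpM2l ?(ltW a0)// normr_sinT_gker.
Qed.

Lemma normr_mul_sinT_gker a x : 0 < a -> `|x * sinT (gker a) x| <= 2 * gammaR (a + 1).
Proof.
move=> a0; have a1 : 0 < a + 1 by lra.
have -> : x * sinT (gker a) x = a * cosT (gker a) x - cosT (gker (a + 1)) x.
  by rewrite cosT_gkerS//; ring.
rewrite (le_trans (ler_normB _ _))// mulr_natl mulr2n lerD//; last exact: normr_cosT_gker.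
by rewrite normrM (gtr0_norm a0) gammaRS// ler_wpM2l ?(ltW a0)// normr_cosT_gker.
Qed.

(** Decay like (1 + x²)^-1, which a product of two factors of size 1/|x| attains; this weak rate
    already gives integrability, so no exponential bound on Γ is needed. *)
Definition sqdecay f := exists K, forall x, `|f x| * (1 + x ^+ 2) <= K.

Lemma sqdecay_L1 f : measurable_fun setT f -> sqdecay f -> L1 f.
Proof.
move=> mf [K fK]; apply: (dominated_L1 mf _ (L1_scale K L1_oneDsqrV)) => x.
by rewrite ler_pdivlMr// ltr_pwDl// sqr_ge0.
Qed.

Lemma sqdecayD f g : sqdecay f -> sqdecay g -> sqdecay (fun x => f x + g x).
Proof.
move=> [K fK] [L gL]; exists (K + L) => x.
apply: le_trans (lerD (fK x) (gL x)); rewrite -mulrDl ler_wpM2r ?ler_normD//.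
by rewrite addr_ge0// sqr_ge0.
Qed.

Lemma sqdecayN f : sqdecay f -> sqdecay (fun x => - f x).
Proof. by move=> [K fK]; exists K => x; rewrite normrN. Qed.

Lemma sqdecay_mul_bounded f g M : sqdecay f -> (forall x, `|g x| <= M) ->
  sqdecay (fun x => f x * g x).
Proof.
move=> [K fK] gM; exists (K * M) => x; rewrite normrM mulrAC.
by apply: ler_pM => //; apply: mulr_ge0 => //; rewrite addr_ge0// sqr_ge0.
Qed.

Lemma sqdecay_mul f g M N K L : (forall x, `|f x| <= M) -> (forall x, `|g x| <= N) ->
  (forall x, `|x * f x| <= K) -> (forall x, `|x * g x| <= L) ->
  sqdecay (fun x => f x * g x).
Proof.
move=> fM gN fK gL; exists (M * N + K * L) => x.
rewrite mulrDr mulr1 lerD//; first by rewrite normrM ler_pM.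
rewrite (_ : _ * _ = `|x * f x| * `|x * g x|); first by rewrite ler_pM.
by rewrite -[x ^+ 2]ger0_norm ?sqr_ge0// -!normrM; congr `| _ |; ring.
Qed.

(* [gcorr a c] is the correlation of [gker a] with [gker c]; its Fourier
   transform at [x] is [Gamma (a + i x) Gamma (c - i x)]. *)
Definition gcorr a c := convolution (gker a) (fun u => gker c (- u)).

(** With s = exp(-y) this is s^c (1+s)^-(a+c), the integrand of the beta integral over the half-line
    with respect to ds/s. *)
Definition beta_ker a c y := expR (- (c * y) - (a + c) * ln (1 + expR (- y))).

(** The exponent of the correlation contains -exp u (1 + exp(-y)). Translating [u] by
    [ln (1 + expR (- y))] absorbs the second factor and leaves the integral for Γ(a+c). *)
Lemma gcorrE a c y : 0 < a -> 0 < c -> gcorr a c y = gammaR (a + c) * beta_ker a c y.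
Proof.
move=> a0 c0; have ac0 : 0 < a + c by lra.
have y1 : 0 < 1 + expR (- y) by rewrite addr_gt0// expR_gt0.
pose l := ln (1 + expR (- y)).
rewrite /gammaR -(Rintegral_shift l (L1_gker ac0)) -RintegralZr//; last first.
  exact: (integrable_shift l (L1_gker ac0)).
apply: eq_Rintegral => u _; rewrite /gker /beta_ker -!expRD; congr expR.
rewrite -/l (expRD u l) /l lnK ?posrE// opprB (expRD u (- y)); ring.
Qed.

Lemma L1_gker_reflect c : 0 < c -> L1 (fun u => gker c (- u)).
Proof. by move=> c0; exact: (integrable_reflect (L1_gker c0)). Qed.

Lemma gker_reflect_bounded c : 0 < c -> exists M, forall u, `|gker c (- u)| <= M.
Proof. by move=> /expdecay_gker/expdecay_bounded[M gM]; exists M => u. Qed.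

Lemma L1_gcorr a c : 0 < a -> 0 < c -> L1 (gcorr a c).
Proof.
move=> a0 c0; have [M cM] := gker_reflect_bounded c0.
exact: (L1_conv (L1_gker a0) (L1_gker_reflect c0) cM).
Qed.

Lemma gcorr_bounded a c : 0 < a -> 0 < c -> exists M, forall u, `|gcorr a c u| <= M.
Proof.
move=> a0 c0; have [M cM] := gker_reflect_bounded c0.
by exists (M * \int[mu]_u `|gker a u|) => y; apply: (normr_conv y (L1_gker a0) (L1_gker_reflect c0) cM).
Qed.

Lemma continuous_gcorr a c : 0 < a -> 0 < c -> continuous (gcorr a c).
Proof.
move=> a0 c0; have [M cM] := gker_reflect_bounded c0.
apply: (continuous_conv (L1_gker a0) (L1_gker_reflect c0) cM).
by apply: continuous_compr; [exact: continuous_gker|exact: opp_continuous].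
Qed.

Lemma cosT_gcorr a c x : 0 < a -> 0 < c -> cosT (gcorr a c) x =
  cosT (gker a) x * cosT (gker c) x + sinT (gker a) x * sinT (gker c) x.
Proof.
move=> a0 c0; have [M cM] := gker_reflect_bounded c0.
rewrite (cosT_conv x (L1_gker a0) (L1_gker_reflect c0) cM).
by rewrite cosT_reflect ?sinT_reflect; [ring|exact: L1_gker..].
Qed.

Lemma sinT_gcorr a c x : 0 < a -> 0 < c -> sinT (gcorr a c) x =
  sinT (gker a) x * cosT (gker c) x - cosT (gker a) x * sinT (gker c) x.
Proof.
move=> a0 c0; have [M cM] := gker_reflect_bounded c0.
rewrite (sinT_conv x (L1_gker a0) (L1_gker_reflect c0) cM).
by rewrite cosT_reflect ?sinT_reflect; [ring|exact: L1_gker..].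
Qed.

Lemma sqdecay_cosT_gcorr a c : 0 < a -> 0 < c -> sqdecay (cosT (gcorr a c)).
Proof.
move=> a0 c0.
have -> : cosT (gcorr a c) = (fun x => 
  cosT (gker a) x * cosT (gker c) x + sinT (gker a) x * sinT (gker c) x).
  by apply/funext => x; rewrite cosT_gcorr.
apply: sqdecayD; apply: sqdecay_mul => x.
all: by [exact: normr_cosT_gker|exact: normr_sinT_gker|
         exact: normr_mul_cosT_gker|exact: normr_mul_sinT_gker].
Qed.

Lemma sqdecay_sinT_gcorr a c : 0 < a -> 0 < c -> sqdecay (sinT (gcorr a c)).
Proof.
move=> a0 c0.
have -> : sinT (gcorr a c) = (fun x => 
  sinT (gker a) x * cosT (gker c) x + - (cosT (gker a) x * sinT (gker c) x)).
  by apply/funext => x; rewrite sinT_gcorr.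
apply: sqdecayD; last apply: sqdecayN; apply: sqdecay_mul => x.
all: by [exact: normr_cosT_gker|exact: normr_sinT_gker|
         exact: normr_mul_cosT_gker|exact: normr_mul_sinT_gker].
Qed.

(** Euler's evaluation of B(a,c): the integral of [gcorr a c] is computed once from its closed form
    and once as the integral of a convolution. *)
Lemma Rintegral_beta_ker a c : 0 < a -> 0 < c ->
  gammaR (a + c) * \int[mu]_u beta_ker a c u = gammaR a * gammaR c.
Proof.
move=> a0 c0; have [M cM] := gker_reflect_bounded c0.
have := Rintegral_convE (L1_gker a0) (L1_gker_reflect c0) cM.
rewrite -[convolution _ _]/(gcorr a c).
have -> : \int[mu]_v gker c (- v) = gammaR c.
  by rewrite /gammaR (Rintegral_reflect (L1_gker c0)) mul1r.
move=> <-; rewrite -RintegralZl//; last first.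
  have := L1_scale (gammaR (a + c))^-1 (L1_gcorr a0 c0); apply: L1_eq => u.
  by rewrite gcorrE// mulKf// gt_eqF// gammaR_gt0// addr_gt0.
by apply: eq_Rintegral => u _; rewrite gcorrE.
Qed.

Lemma convolution_gcorr0 a b c d : 0 < a -> 0 < b -> 0 < c -> 0 < d ->
  convolution (gcorr a c) (gcorr b d) 0 =
  gammaR (a + c) * gammaR (b + d) * (gammaR (a + d) * gammaR (b + c)) / gammaR (a + b + c + d).
Proof.
move=> a0 b0 c0 d0.
have ad0 : 0 < a + d by lra.
have bc0 : 0 < b + c by lra.
have s0 : 0 < gammaR (a + b + c + d) by apply: gammaR_gt0; lra.
have sE : a + b + c + d = (a + d) + (b + c) by ring.
(* Since ln(1 + exp u) = u + ln(1 + exp(-u)), the product of the two beta kernels is again a beta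
   kernel, with parameters a+d and b+c. This produces the crossed Gamma factors of Barnes'
   formula. *)
have kE u : beta_ker a c u * beta_ker b d (- u) = beta_ker (a + d) (b + c) u.
  rewrite /beta_ker opprK.
  have -> : ln (1 + expR u) = u + ln (1 + expR (- u)) by
    rewrite -{2}(expRK u) -lnM ?posrE ?expR_gt0 ?addr_gt0 ?expR_gt0//;
    congr ln; rewrite mulrDr mulr1 -expRD subrr expR0 addrC.
  rewrite -expRD; congr expR; ring.
rewrite -(Rintegral_beta_ker ad0 bc0) -sE [gammaR (a + b + c + d) * _]mulrC.
rewrite [_ * (_ * gammaR _)]mulrA mulfK ?gt_eqF//.
have Lb : L1 (beta_ker (a + d) (b + c)).
  have := L1_scale (gammaR (a + b + c + d))^-1 (L1_gcorr ad0 bc0); apply: L1_eq => u.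
  by rewrite gcorrE// -sE mulKf// gt_eqF.
rewrite -RintegralZl//; apply: eq_Rintegral => u _.
by rewrite sub0r !gcorrE// mulrACA kE.
Qed.

End barnes_real.

(** * Linearity of complex-valued integrals *)

Section has_cintegral.
Context d (T : measurableType d) (R : realType).
Variable m : {measure set T -> \bar R}.
Implicit Types (f g : T -> R[i]) (v w k : R[i]).

(** Integrability and value are bundled because every rule below propagates both, and the final
    statement asserts both. *)
Definition has_cintegral f v := cintegrable m setT f /\ cintegral m setT f = v.

Lemma has_cintegral_eq f g v w : f =1 g -> v = w -> has_cintegral f v -> has_cintegral g w.
Proof. by move=> /funext -> ->. Qed.

Let integrableZD (a b : R) (f g : T -> R) :
  m.-integrable setT (EFin \o f) -> m.-integrable setT (EFin \o g) ->
  m.-integrable setT (EFin \o (fun x => a * f x + b * g x)).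
Proof.
move=> fi gi.
have := integrableD measurableT (integrableZl measurableT a fi) (integrableZl measurableT b gi).
exact: eq_integrable.
Qed.

Let RintegralZD (a b : R) (f g : T -> R) :
  m.-integrable setT (EFin \o f) -> m.-integrable setT (EFin \o g) ->
  \int[m]_x (a * f x + b * g x) = a * \int[m]_x f x + b * \int[m]_x g x.
Proof.
move=> fi gi; rewrite RintegralD// ?RintegralZl//.
  by have := integrableZl measurableT a fi; exact: eq_integrable.
by have := integrableZl measurableT b gi; exact: eq_integrable.
Qed.

Lemma has_cintegralZ k f v : has_cintegral f v ->
  has_cintegral (fun x => k * f x) (k * v).
Proof.
move=> [[fr fi] <-]; case: k => kr ki.
have reE x : complex.Re ((kr +i* ki) * f x) = kr * complex.Re (f x) + (- ki) * complex.Im (f x).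
  by case: (f x) => p q /=; ring.
have imE x : complex.Im ((kr +i* ki) * f x) = kr * complex.Im (f x) + ki * complex.Re (f x).
  by case: (f x) => p q /=; ring.
split; first split.
- by have := integrableZD kr (- ki) fr fi; apply: eq_integrable => // x _ /=; rewrite reE.
- by have := integrableZD kr ki fi fr; apply: eq_integrable => // x _ /=; rewrite imE.
- rewrite /cintegral; under eq_Rintegral do rewrite reE.
  under [X in _ +i* X]eq_Rintegral do rewrite imE.
  by rewrite !RintegralZD//; apply/eqP; rewrite eq_complex/= mulNr eqxx/= addrC.
Qed.

Lemma has_cintegralD f g v w : has_cintegral f v -> has_cintegral g w ->
  has_cintegral (fun x => f x + g x) (v + w).
Proof.
move=> [[fr fi] <-] [[gr gi] <-].
have reE x : complex.Re (f x + g x) = 1 * complex.Re (f x) + 1 * complex.Re (g x).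
  by rewrite !mul1r; case: (f x) (g x) => p q [].
have imE x : complex.Im (f x + g x) = 1 * complex.Im (f x) + 1 * complex.Im (g x).
  by rewrite !mul1r; case: (f x) (g x) => p q [].
split; first split.
- by have := integrableZD 1 1 fr gr; apply: eq_integrable => // x _ /=; rewrite reE.
- by have := integrableZD 1 1 fi gi; apply: eq_integrable => // x _ /=; rewrite imE.
- rewrite /cintegral; under eq_Rintegral do rewrite reE.
  under [X in _ +i* X]eq_Rintegral do rewrite imE.
  by rewrite !RintegralZD// !mul1r.
Qed.

Lemma has_cintegral0 : has_cintegral (fun=> 0) 0.
Proof.
split; first by split; exact: integrable0.
by rewrite /cintegral /Rintegral/= integral0.
Qed.

Lemma has_cintegral_sum n (f : 'I_n -> T -> R[i]) (v : 'I_n -> R[i]) :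
  (forall i, has_cintegral (f i) (v i)) ->
  has_cintegral (fun x => \sum_(i < n) f i x) (\sum_(i < n) v i).
Proof.
elim: n f v => [|n IH] f v fv.
  by apply: has_cintegral_eq has_cintegral0 => [x|]; rewrite big_ord0.
have := has_cintegralD (IH _ _ (fun i => fv (widen_ord (leqnSn n) i))) (fv ord_max).
by apply: has_cintegral_eq => [x|]; rewrite big_ord_recr.
Qed.

End has_cintegral.

(** * The complex Gamma function and Barnes' lemma in complex form *)

Section complex_gamma.
Context {R : realType}.
Implicit Types (a b c d x : R) (z : R[i]).

Lemma Gamma_real a : 0 < a -> Gamma a%:C = (gammaR a)%:C.
Proof.
move=> a0; rewrite Gamma_gker// -gammaRE; congr (_ +i* _).
have := sinTN 0 (L1_gker a0); rewrite oppr0; lra.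
Qed.

Lemma Gamma_gt0_neq0 a : 0 < a -> Gamma a%:C != 0 :> R[i].
Proof.
by move=> a0; rewrite Gamma_real// eq_complex/= negb_and gt_eqF// gammaR_gt0.
Qed.

Lemma GammaS z : 0 < complex.Re z -> Gamma (z + 1) = z * Gamma z.
Proof.
case: z => a x /= a0; have a1 : 0 < a + 1 by lra.
have -> : (a +i* x) + 1 = (a + 1) +i* x :> R[i].
  by apply/eqP; rewrite eq_complex/= addr0 !eqxx.
by rewrite !Gamma_gker// cosT_gkerS// sinT_gkerS.
Qed.

Lemma Re_natD z k : complex.Re (z + k%:R) = complex.Re z + k%:R.
Proof. by rewrite -(rmorph_nat (real_complex R)); case: z. Qed.

Lemma Gamma_poch z k : 0 < complex.Re z -> Gamma (z + k%:R) = poch z k * Gamma z.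
Proof.
move=> z0; elim: k => [|k IH]; first by rewrite addr0 /poch big_ord0 mul1r.
rewrite -natr1 addrA GammaS; last first.
  rewrite Re_natD.
  by rewrite ltr_wpDr.
by rewrite IH /poch big_ord_recr/= mulrCA mulrA.
Qed.

(** The integrand is the derivative of -exp(-exp u). This value matches the limit built into [h_den]
    at its removable singularity. *)
Lemma Gamma1 : Gamma 1 = 1 :> R[i].
Proof.
rewrite -[X in Gamma X]/((1 : R)%:C) Gamma_real//; congr (_%:C).
pose F (u : R) := - expR (- expR u).
have dF (u : R) : is_derive u (1 : R) F (gker 1 u).
  have d1 := is_deriveN (is_derive_expR_comp (is_deriveN (is_derive_expR u))).
  apply: (is_derive_eq d1).
  by rewrite mulrN opprK /gker mul1r expRD mulrC.
have -> : gammaR 1 = 0 - (-1) :> R; last by rewrite sub0r opprK.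
apply: (Rintegral_FTC_T _ dF).
- exact: continuous_gker.
- exact: L1_gker.
- apply: norm_cvg0; apply: (squeeze_cvgr _ (cvg_cst 0) (@cvgn_expRN _ 1 ltr01)).
  near=> n; rewrite normr_ge0/= /F normrN ger0_norm ?expR_ge0// ler_expR lerN2 mul1r.
  by apply: le_trans (expR_ge1Dx _); rewrite lerDr.
- apply: cvgN; rewrite -[X in _ --> X](expR0 R) -oppr0.
  apply: (@cvg_comp _ _ _ (fun n => - expR (- n%:R)) expR _ (nbhs (- 0 : R))); last exact: continuous_expR.
  apply: cvgN; apply: cvg_trans (@cvgn_expRN _ 1 ltr01); apply: near_eq_cvg.
  by near=> n; rewrite mul1r.
Unshelve. all: by end_near. Qed.

Lemma Gamma_pair a c x : 0 < a -> 0 < c ->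
  Gamma (a +i* x) * Gamma (c +i* - x) =
  cosT (gcorr a c) x +i* sinT (gcorr a c) x.
Proof.
move=> a0 c0; rewrite !Gamma_gker// cosT_gcorr// sinT_gcorr// cosTN (sinTN x (L1_gker c0)).
by apply/eqP; rewrite eq_complex/= !mulrN opprK eqxx/= addrC.
Qed.

(** Factors with opposite signs of [x] are paired, so that each pair is the transform of a
    correlation and the whole integrand that of a convolution [F]. Its imaginary part is odd and
    integrates to 0; its real part is inverted at 0. *)
Theorem barnes_first_lemma a b c d : 0 < a -> 0 < b -> 0 < c -> 0 < d ->
  has_cintegral (@lebesgue_measure R)
    (fun x : measurableTypeR R =>
       (Gamma (a +i* x) * Gamma (c +i* - x)) * (Gamma (b +i* x) * Gamma (d +i* - x)))
    (2 * pi%:C * (Gamma (a + c)%:C * Gamma (b + d)%:C * (Gamma (a + d)%:C * Gamma (b + c)%:C)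
       / Gamma (a + b + c + d)%:C)).
Proof.
move=> a0 b0 c0 d0.
pose F := convolution (gcorr a c) (gcorr b d).
have [M bdM] := gcorr_bounded b0 d0.
have Lac := L1_gcorr a0 c0; have Lbd := L1_gcorr b0 d0.
have LF : L1 F by exact: L1_conv Lac Lbd bdM.
have fE x : (Gamma (a +i* x) * Gamma (c +i* - x)) * (Gamma (b +i* x) * Gamma (d +i* - x))
    = cosT F x +i* sinT F x.
  rewrite !Gamma_pair// (cosT_conv x Lac Lbd bdM) (sinT_conv x Lac Lbd bdM).
  by apply/eqP; rewrite eq_complex/= eqxx/= addrC.
have cb x : `|cosT (gcorr b d) x| <= \int[lebesgue_measure]_u `|gcorr b d u|.
  exact: normr_cosT.
have sb x : `|sinT (gcorr b d) x| <= \int[lebesgue_measure]_u `|gcorr b d u|.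
  exact: normr_sinT.
(* Quadratic decay of the pair (a,c) is enough; the pair (b,d) is merely bounded. *)
have cL : L1 (cosT F).
  apply: sqdecay_L1; first by apply: continuous_measurable_fun; exact: continuous_cosT.
  have := sqdecayD (sqdecay_mul_bounded (sqdecay_cosT_gcorr a0 c0) cb)
    (sqdecayN (sqdecay_mul_bounded (sqdecay_sinT_gcorr a0 c0) sb)).
  by congr sqdecay; apply/funext => x; rewrite (cosT_conv x Lac Lbd bdM).
have sL : L1 (sinT F).
  apply: sqdecay_L1; first by apply: continuous_measurable_fun; exact: continuous_sinT.
  have := sqdecayD (sqdecay_mul_bounded (sqdecay_sinT_gcorr a0 c0) cb)
    (sqdecay_mul_bounded (sqdecay_cosT_gcorr a0 c0) sb).
  by congr sqdecay; apply/funext => x; rewrite (sinT_conv x Lac Lbd bdM).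
split.
  split; [move: cL|move: sL]; apply: eq_integrable => // x _.
  - by rewrite /= fE.
  - by rewrite /= fE.
rewrite /cintegral.
under eq_Rintegral do rewrite fE/=.
under [X in _ +i* X]eq_Rintegral do rewrite fE/=.
rewrite (Rintegral_odd sL); last by move=> x; rewrite sinTN.
rewrite (@fourier_inversion0 _ F (M * \int[lebesgue_measure]_u `|gcorr a c u|)) //; last 2 first.
- exact: (continuous_conv Lac Lbd bdM (continuous_gcorr b0 d0)).
- by move=> u; exact: (normr_conv u Lac Lbd bdM).
rewrite /F convolution_gcorr0// !Gamma_real; [|lra..].
set t := (X in X +i* 0); rewrite -[_ +i* _]/(t%:C) /t.
by rewrite !(rmorphM, fmorphV, rmorph_nat)/=.
Qed.

End complex_gamma.

(** * Integrals of products over Euclidean space *)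

Section product_integral.
Context d1 d2 (T1 : measurableType d1) (T2 : measurableType d2) (R : realType).
Variables (m1 : {sigma_finite_measure set T1 -> \bar R})
          (m2 : {sigma_finite_measure set T2 -> \bar R}).

Lemma Rintegral_prodM (f : T1 -> R) (g : T2 -> R) :
  m1.-integrable setT (EFin \o f) -> m2.-integrable setT (EFin \o g) ->
  (m1 \x m2)%E.-integrable setT (EFin \o (fun p => f p.1 * g p.2)) /\
  \int[(m1 \x m2)%E]_p (f p.1 * g p.2) = (\int[m1]_x f x) * \int[m2]_y g y.
Proof.
move=> fi gi.
have mf : measurable_fun setT f by apply/measurable_EFinP; exact: measurable_int fi.
have mg : measurable_fun setT g by apply/measurable_EFinP; exact: measurable_int gi.
have gxi x : m2.-integrable setT (EFin \o (fun y => f x * g y)).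
  by have := integrableZl measurableT (f x) gi; exact: eq_integrable.
have fgi : (m1 \x m2)%E.-integrable setT (EFin \o (fun p => f p.1 * g p.2)).
  apply: (@prod_integrable _ _ _ _ _ m1 m2 _ (fun x => (\int[m2]_y `|g y|) * `|f x|)).
  - by apply: measurable_funM; exact: measurableT_comp.
  - exact: gxi.
  - move=> x /=; under eq_Rintegral do rewrite normrM.
    by rewrite RintegralZl// 1?mulrC//; exact: integrable_norm.
  - have := integrableZl measurableT (\int[m2]_y `|g y|) (integrable_norm fi).
    exact: eq_integrable.
split => //.
rewrite {1}/Rintegral -(integral12_prod_meas1 fgi) /fubini_F/=.
rewrite -RintegralZr// /Rintegral; congr fine; apply: eq_integral => x _.
rewrite -(fineK (integrable_fin_num _ (gxi x)))//=; congr EFin.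
by rewrite -/(Rintegral m2 setT (fun y => f x * g y)) RintegralZl.
Qed.

Lemma has_cintegral_prodM (f : T1 -> R[i]) (g : T2 -> R[i]) (v w : R[i]) :
  has_cintegral m1 f v -> has_cintegral m2 g w ->
  has_cintegral (m1 \x m2)%E (fun p => f p.1 * g p.2) (v * w).
Proof.
move=> [[fr fi] <-] [[gr gi] <-].
have [rri rrE] := Rintegral_prodM fr gr.
have [rii riE] := Rintegral_prodM fr gi.
have [iri irE] := Rintegral_prodM fi gr.
have [iii iiE] := Rintegral_prodM fi gi.
have reE p : complex.Re (f p.1 * g p.2) = complex.Re (f p.1) * complex.Re (g p.2) -
    complex.Im (f p.1) * complex.Im (g p.2).
  by case: (f p.1) (g p.2) => ? ? [].
have imE p : complex.Im (f p.1 * g p.2) = complex.Re (f p.1) * complex.Im (g p.2) +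
    complex.Im (f p.1) * complex.Re (g p.2).
  by case: (f p.1) (g p.2) => ? ? [].
split; first split.
- have := integrableB measurableT rri iii.
  by apply: eq_integrable => // p _ /=; rewrite reE.
- have := integrableD measurableT rii iri.
  by apply: eq_integrable => // p _ /=; rewrite imE.
- rewrite /cintegral; under eq_Rintegral do rewrite reE.
  under [X in _ +i* X]eq_Rintegral do rewrite imE.
  rewrite RintegralB// RintegralD//.
  by rewrite rrE riE irE iiE.
Qed.

End product_integral.

Section euclidean_integral.
Context {R : realType}.

(** Transfer to an image measure needs [F] measurable, which is not assumed. It follows from
    measurability of the composite with [euclidean_cons], because that map has the measurable
    inverse [u]. *)
Lemma has_cintegral_lebesgue_step r (m : {sigma_finite_measure set (euclidean R r) -> \bar R})
    (F : euclidean R r.+1 -> R[i]) v :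
  has_cintegral (@lebesgue_measure R \x m)%E (fun p => F (euclidean_cons p)) v ->
  has_cintegral (lebesgue_step m) F v.
Proof.
move=> [[Fr Fi] <-].
pose u (v : euclidean R r.+1) : measurableTypeR R * euclidean R r :=
  (thead v, [tuple of behead v]).
have mu : measurable_fun setT u.
  apply/measurable_fun_pairP; split => /=.
    exact: measurable_tnth.
  exact: measurable_behead.
have uK w : euclidean_cons (u w) = w.
  by apply/val_inj => /=; case/tupleP: w => x t /=; rewrite theadE.
have key (h : R[i] -> R) :
    (@lebesgue_measure R \x m)%E.-integrable setT (EFin \o (fun p => h (F (euclidean_cons p)))) ->
    (lebesgue_step m).-integrable setT (EFin \o (fun x => h (F x))) /\
    \int[lebesgue_step m]_x h (F x) = \int[(@lebesgue_measure R \x m)%E]_p h (F (euclidean_cons p)).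
  move=> hi.
  have mh : measurable_fun setT (EFin \o (fun x => h (F x))).
    have -> : EFin \o (fun x => h (F x)) =
        (EFin \o (fun p => h (F (euclidean_cons p)))) \o u.
      by apply/funext => w /=; rewrite uK.
    by apply: measurableT_comp => //; exact: measurable_int hi.
  split.
    exact: (integrable_pushforward (@measurable_euclidean_cons R r) mh hi measurableT).
  rewrite /Rintegral; congr fine.
  exact: (integral_pushforward (@measurable_euclidean_cons R r) mh hi measurableT).
have [ri rE] := key _ Fr; have [ii iE] := key _ Fi.
by split => //; rewrite /cintegral rE iE.
Qed.

Lemma has_cintegral_prod_tuple r (f : 'I_r -> measurableTypeR R -> R[i]) (v : 'I_r -> R[i]) :
  (forall j, has_cintegral (@lebesgue_measure R) (f j) (v j)) ->
  has_cintegral (lebesgue_measure_n R r) (fun x => \prod_(j < r) f j (tnth x j))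
    (\prod_(j < r) v j).
Proof.
elim: r f v => [|r IH] f v fv.
  rewrite big_ord0; apply: (@has_cintegral_eq _ _ _ _ (fun=> 1) _ 1) => // [x|].
    by rewrite big_ord0.
  have ci (c : R) : (\d_([tuple] : euclidean R 0)).-integrable setT (EFin \o cst c).
    by apply: finite_measure_integrable_cst.
  have iE (c : R) : \int[\d_([tuple] : euclidean R 0)]_x (cst c x) = c.
    by rewrite /Rintegral integral_dirac//= indicT mul1r.
  split; first by split; [exact: (ci 1)|exact: (ci 0)].
  by rewrite /cintegral/= (iE 1) (iE 0).
rewrite big_ord_recl.
apply: has_cintegral_lebesgue_step.
have := has_cintegral_prodM (fv ord0) (IH _ _ (fun j => fv (lift ord0 j))).
apply: has_cintegral_eq => // p.
rewrite big_ord_recl; congr (_ * _); apply: eq_bigr => j _.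
by rewrite /euclidean_cons tnthS.
Qed.

End euclidean_integral.

(** * Finite differences and terminating hypergeometric sums *)

Section finite_differences.
Variable K : fieldType.
Implicit Types (f g : nat -> K) (c A : K).

(** Minus the forward difference: with this sign the n-th iterate is the alternating binomial sum
    without a global factor (-1)^n. *)
Definition bdiff f k := f k - f k.+1.

Lemma eq_bdiff f g : f =1 g -> bdiff f =1 bdiff g.
Proof. by move=> fg k; rewrite /bdiff !fg. Qed.

Lemma eq_iter_bdiff n f g : f =1 g -> iter n bdiff f =1 iter n bdiff g.
Proof. by move=> fg; elim: n => //= n IH; exact: eq_bdiff. Qed.

Lemma iter_bdiffD n f g k :
  iter n bdiff (fun k => f k + g k) k = iter n bdiff f k + iter n bdiff g k.
Proof.
elim: n k => //= n IH k; rewrite (eq_bdiff IH) /bdiff; ring.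
Qed.

Lemma iter_bdiffZ n c f k : iter n bdiff (fun k => c * f k) k = c * iter n bdiff f k.
Proof.
elim: n k => //= n IH k; rewrite (eq_bdiff IH) /bdiff; ring.
Qed.

Lemma sum_binomial_bdiff n f k :
  \sum_(i < n.+1) (-1) ^+ i * 'C(n, i)%:R * f (k + i)%N = iter n bdiff f k.
Proof.
elim: n f k => [|n IH] f k.
  by rewrite big_ord1 bin0 expr0 !mul1r addn0.
rewrite iterSr -IH big_ord_recl /= bin0 expr0 !mul1r addn0.
under eq_bigr do rewrite binS natrD mulrDr mulrDl.
rewrite big_split/= big_ord_recr/= bin_small// mulr0 mul0r addr0.
under [RHS]eq_bigr do rewrite /bdiff mulrBr.
rewrite sumrB addrA; congr (_ + _).
  rewrite [RHS]big_ord_recl/= bin0 expr0 !mul1r addn0; congr (_ + _).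
rewrite -sumrN; apply: eq_bigr => i _.
by rewrite /bump/= add1n exprS addnS; ring.
Qed.

(* [f] is a polynomial function of degree less than [n]. *)
Definition fdeg_lt n f := forall k, iter n bdiff f k = 0.

Lemma fdeg_ltS n f : fdeg_lt n f -> fdeg_lt n.+1 f.
Proof. by move=> fn k; rewrite /= /bdiff !fn subrr. Qed.

Lemma fdeg_lt_linear n c f :
  fdeg_lt n f -> fdeg_lt n.+1 (fun k => (c + k%:R) * f k).
Proof.
elim: n c f => [|n IH] c f fn k.
  have f0 i : f i = 0 := fn i.
  by rewrite /= /bdiff !f0 !mulr0 subrr.
rewrite iterSr.
(* Leibniz rule for the difference: the linear factor is kept on the difference of [f], and the
   remaining term already has degree less than n+1. *)
have dE : bdiff (fun k => (c + k%:R) * f k) =1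
    (fun k => ((c + 1) + k%:R) * bdiff f k + (-1) * f k).
  by move=> i; rewrite /bdiff -natr1; ring.
rewrite (eq_iter_bdiff n.+1 dE) iter_bdiffD iter_bdiffZ fn mulr0 addr0.
by apply: IH => i; rewrite -iterSr.
Qed.

(** This is the partial fraction expansion of n!/((A+k)...(A+k+n)), read as an iterated
    difference. *)
Lemma iter_bdiff_inv n A k : (forall i, A + i%:R != 0) ->
  iter n bdiff (fun i => (A + i%:R)^-1) k = n`!%:R / \prod_(i < n.+1) (A + (k + i)%:R).
Proof.
move=> A0; elim: n k => [|n IH] k /=.
  by rewrite big_ord1 addn0 fact0 div1r.
have p0 m l : \prod_(i < m) (A + (l + i)%:R) != 0 :> K by apply/prodf_neq0 => i _.
rewrite (eq_bdiff IH) /bdiff big_ord_recl [X in _ = _ / X]big_ord_recl.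
rewrite [X in _ = _ / (_ * X)]big_ord_recr/= [X in _ - _ / X]big_ord_recr/=.
have -> : \prod_(i < n) (A + (k.+1 + i)%:R) = \prod_(i < n) (A + (k + bump 0 i)%:R) :> K.
  by apply: eq_bigr => i _; rewrite /bump/= add1n addnS addSn.
have -> : \prod_(i < n) (A + (k + bump 0 (widen_ord (leqnSn n) i))%:R) =
  \prod_(i < n) (A + (k + bump 0 i)%:R) :> K by [].
set P := \prod_(i < n) _.
have P0 : P != 0.
  have := p0 n k.+1; congr (_ != 0); apply: eq_bigr => i _.
  by rewrite /bump/= add1n addnS addSn.
have h1 := A0 k; have h2 := A0 (k + n.+1)%N.
rewrite /bump/= add1n addn0 addSn -addnS factS natrM.
have -> : (k + n.+1)%:R = k%:R + (n.+1)%:R :> K by rewrite natrD.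
rewrite natrD in h2.
field; rewrite P0 h1 !andbT/= nat1r; exact: h2.
Qed.

End finite_differences.

Section pochhammer.
Context {R : realType}.
Implicit Types (c z : R[i]) (k l n : nat).

Lemma poch0 c : poch c 0 = 1. Proof. by rewrite /poch big_ord0. Qed.

Lemma pochS c n : poch c n.+1 = poch c n * (c + n%:R).
Proof. by rewrite /poch big_ord_recr. Qed.

Lemma pochD c k l : poch c (k + l) = poch c k * poch (c + k%:R) l.
Proof.
elim: l => [|l IH]; first by rewrite addn0 poch0 mulr1.
by rewrite addnS !pochS IH natrD addrA mulrA.
Qed.

Lemma poch_reflect c n : poch (1 - c - n%:R) n = (-1) ^+ n * poch c n.
Proof.
rewrite /poch [in RHS](reindex_inj rev_ord_inj)/= -[X in _ ^+ X](card_ord n) -prodr_const -big_split/=.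
apply: eq_bigr => i _.
have -> : (n%:R : R[i]) = (n - i.+1)%:R + i.+1%:R by rewrite -natrD subnK.
by rewrite -natr1; ring.
Qed.

Lemma poch_negn n k : (k <= n)%N ->
  poch (- n%:R) k / k`!%:R = (-1) ^+ k * 'C(n, k)%:R :> R[i].
Proof.
move=> kn.
have k0 : (k`!%:R : R[i]) != 0 by rewrite pnatr_eq0 -lt0n fact_gt0.
apply: (canLR (mulfK k0)); rewrite -mulrA -natrM bin_ffact ffact_prod.
rewrite /poch -[X in _ ^+ X](card_ord k) -prodr_const natr_prod -big_split/=.
apply: eq_bigr => i _; rewrite natrB; first by ring.
by rewrite (leq_trans _ kn)// ltnW.
Qed.

Lemma poch_negn_eq0 n k : (n < k)%N -> poch (- n%:R) k = 0 :> R[i].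
Proof.
move=> nk; rewrite /poch (bigD1 (Ordinal nk))//= addNr mul0r //.
Qed.

Lemma poch_neq0 c k : (forall i, c + i%:R != 0) -> poch c k != 0.
Proof. by move=> c0; apply/prodf_neq0 => i _. Qed.

(** The factor [poch (- n%:R) k] vanishes for k > n, so the partial sums are eventually constant.
    Divided by k! it becomes a signed binomial coefficient, which brings the sum into the form of an
    n-th difference. *)
Lemma hyp3F2_negn n c2 c3 d1 d2 :
  hyp3F2 (- n%:R) c2 c3 d1 d2 1 =
  \sum_(k < n.+1) (-1) ^+ k * 'C(n, k)%:R * (poch c2 k * poch c3 k / (poch d1 k * poch d2 k)) :> R[i].
Proof.
rewrite /hyp3F2; set u := (fun k => _).
have -> : \sum_(k < n.+1) (-1) ^+ k * 'C(n, k)%:R * (poch c2 k * poch c3 k / (poch d1 k * poch d2 k))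
   = \sum_(0 <= k < n.+1) u k.
  rewrite big_mkord; apply: eq_bigr => k _.
  rewrite /u expr1n -poch_negn -1?ltnS//; ring.
apply: (@cvg_lim R[i]^o); first exact: norm_hausdorff.
apply: cvg_near_cst; near=> m.
have nm : (n.+1 <= m)%N by near: m; exact: nbhs_infty_ge.
rewrite /series/= (big_cat_nat (leq0n n.+1) nm)//= [X in _ + X]big1_seq ?addr0// => k.
by rewrite mem_index_iota => /andP[_ /andP[nk _]]; rewrite /u poch_negn_eq0// !mul0r.
Unshelve. all: by end_near. Qed.

End pochhammer.

(** * Evaluation of the hypergeometric double sum *)

Section hahn_sums.
Context {R : realType}.
Implicit Types (c z A D sigma t P Q : R[i]) (k l n m : nat).

Lemma Re_gt0_neq0 z k : 0 < complex.Re z -> z + k%:R != 0.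
Proof.
move=> z0; apply/eqP => /(congr1 (@complex.Re R)); rewrite Re_natD/= => h.
by have := ltr_wpDr (ler0n R k) z0; rewrite h ltxx.
Qed.

Lemma fdeg_lt_poch n l c (f : nat -> R[i]) : fdeg_lt n f ->
  fdeg_lt (l + n) (fun k => poch (c + k%:R) l * f k).
Proof.
move=> fn; elim: l => [|l IH] k.
  by rewrite (eq_iter_bdiff _ (_ : _ =1 f)) ?fn// => i; rewrite poch0 mul1r.
have h := fdeg_lt_linear (c + l%:R) IH.
rewrite addSn (eq_iter_bdiff _ (_ : _ =1 (fun k => (c + l%:R + k%:R) * (poch (c + k%:R) l * f k)))) ?h// => i.
by rewrite pochS; ring.
Qed.

Lemma fdeg_lt_cst (c : R[i]) : fdeg_lt 1 (fun=> c).
Proof. by move=> k; rewrite /= /bdiff subrr. Qed.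

Lemma fdeg_ltZ n c (f : nat -> R[i]) : fdeg_lt n f -> fdeg_lt n (fun k => c * f k).
Proof. by move=> fn k; rewrite iter_bdiffZ fn mulr0. Qed.

Lemma sum_binomial_fdeg_lt n (f : nat -> R[i]) : fdeg_lt n f ->
  \sum_(k < n.+1) (-1) ^+ k * 'C(n, k)%:R * f k = 0.
Proof. by move=> fn; rewrite -[RHS](fn 0%N) -sum_binomial_bdiff. Qed.

(** Since (D+m)_k/(D)_k = (D+k)_m/(D)_m, the summand is a polynomial in k of degree at most l + m,
    one less than the order of the difference. *)
Lemma sum_binomial_poch_lt l m D sigma : (forall i : nat, D + i%:R != 0) ->
  \sum_(k < (l + m).+2) (-1) ^+ k * 'C((l + m).+1, k)%:R *
    (poch (D + m%:R) k * poch (sigma + k%:R) l / poch D k) = 0.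
Proof.
move=> D0.
have h : fdeg_lt (l + m).+1 (fun k => (poch D m)^-1 * (poch (sigma + k%:R) l * (poch (D + k%:R) m * 1))).
  apply: fdeg_ltZ; rewrite -addn1 -addnA; apply: fdeg_lt_poch.
  by apply: fdeg_lt_poch; exact: fdeg_lt_cst.
rewrite -[RHS](sum_binomial_fdeg_lt h); apply: eq_bigr => k _; congr (_ * _).
have dk := poch_neq0 k D0; have dm := poch_neq0 m D0.
have e : poch D m * poch (D + m%:R) k = poch D k * poch (D + k%:R) m.
  by rewrite -!pochD addnC.
have -> : poch (D + m%:R) k = poch D k * poch (D + k%:R) m / poch D m.
  by rewrite -e mulrAC mulfV// mul1r.
by field; rewrite dk dm.
Qed.

(** Division of the polynomial (σ+k)_n by A + k; the remainder is its value at k = -A. *)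
Lemma poch_partial_fraction n sigma A : exists2 q : nat -> R[i], fdeg_lt n q &
  forall k, A + k%:R != 0 ->
    poch (sigma + k%:R) n / (A + k%:R) = q k + poch (sigma - A) n / (A + k%:R).
Proof.
elim: n => [|n [q qn qE]].
  by exists (fun=> 0) => [//|k _]; rewrite !poch0 add0r.
exists (fun k => poch (sigma + k%:R) n * 1 + (sigma + n%:R - A) * q k).
  move=> k; rewrite iter_bdiffD iter_bdiffZ (fdeg_ltS qn) mulr0 addr0.
  by rewrite -addn1; apply: fdeg_lt_poch; exact: fdeg_lt_cst.
move=> k Ak; rewrite !pochS.
have -> : q k = poch (sigma + k%:R) n / (A + k%:R) - poch (sigma - A) n / (A + k%:R).
  by rewrite qE// addrK.
by field.
Qed.

(** Since (A)_k/(A+1)_k = A/(A+k), the polynomial part of the partial fraction is killed by the n-th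
    difference and only the remainder at k = -A contributes. In degree 0 the sum is a single term,
    and A = 0 has to be allowed there: A will be σ+t-1. *)
Lemma sum_binomial_poch_eq n A sigma : (forall i : nat, A + 1 + i%:R != 0) ->
  (n != 0%N -> A != 0) ->
  \sum_(k < n.+1) (-1) ^+ k * 'C(n, k)%:R *
    (poch A k * poch (sigma + k%:R) n / poch (A + 1) k) =
  n`!%:R * poch (sigma - A) n / poch (A + 1) n.
Proof.
move=> A1; case: n => [|n] An.
  by rewrite big_ord1 bin0 !poch0 fact0; field.
have A0 i : A + i%:R != 0.
  by case: i => [|i]; [rewrite addr0 An|rewrite -nat1r addrA A1].
have p1 k := poch_neq0 k A1.
have pA k : poch A k / poch (A + 1) k = A / (A + k%:R).
  have e : poch A k * (A + k%:R) = A * poch (A + 1) k.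
    by rewrite -pochS -add1n pochD /poch big_ord1 addr0.
  have -> : poch A k = A * poch (A + 1) k / (A + k%:R) by rewrite -e mulfK.
  by field; rewrite p1 A0.
have [q qn qE] := poch_partial_fraction n.+1 sigma A.
transitivity (\sum_(k < n.+2) (-1) ^+ k * 'C(n.+1, k)%:R *
    (A * q k + A * poch (sigma - A) n.+1 * (A + k%:R)^-1)).
  apply: eq_bigr => k _; congr (_ * _).
  rewrite mulrAC pA.
  transitivity (A * (poch (sigma + k%:R) n.+1 / (A + k%:R))); first by ring.
  by rewrite qE//; ring.
transitivity (iter n.+1 (@bdiff R[i])
    (fun k => A * q k + A * poch (sigma - A) n.+1 * (A + k%:R)^-1) 0%N).
  by rewrite -sum_binomial_bdiff.
rewrite iter_bdiffD !iter_bdiffZ qn mulr0 add0r iter_bdiff_inv//.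
have -> : \prod_(i < n.+2) (A + (0 + i)%:R) = A * poch (A + 1) n.+1.
  have -> : A * poch (A + 1) n.+1 = poch A n.+2.
    by rewrite -[n.+2]add1n pochD [poch A 1]/poch big_ord1 addr0.
  by [].
have := A0 0%N; rewrite addr0 => AA.
by field; rewrite AA p1.
Qed.

(** Writing the Gamma values as Pochhammer symbols cancels the denominators (σ)_k and (P)_k and
    moves everything independent of k in front. *)
Lemma hahn_sum_Gamma n l P sigma t :
  0 < complex.Re P -> 0 < complex.Re sigma -> 0 < complex.Re t ->
  \sum_(k < n.+1) (-1) ^+ k * 'C(n, k)%:R *
    (poch (n%:R + sigma + t - 1) k / (poch sigma k * poch P k)) *
    (Gamma (P + k%:R) * Gamma (sigma + k%:R + l%:R) / Gamma (sigma + t + k%:R + l%:R)) =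
  Gamma P * Gamma sigma / Gamma (sigma + t + l%:R) *
  \sum_(k < n.+1) (-1) ^+ k * 'C(n, k)%:R *
    (poch (n%:R + sigma + t - 1) k * poch (sigma + k%:R) l / poch (sigma + t + l%:R) k).
Proof.
move=> P0 s0 t0; rewrite mulr_sumr; apply: eq_bigr => k _.
have st0 : 0 < complex.Re (sigma + t) by rewrite raddfD/= addr_gt0.
rewrite (Gamma_poch _ P0).
have -> : sigma + k%:R + l%:R = sigma + (k + l)%:R by rewrite natrD addrA.
rewrite (Gamma_poch _ s0) pochD.
have -> : sigma + t + k%:R + l%:R = (sigma + t + l%:R) + k%:R by rewrite addrAC.
rewrite (@Gamma_poch _ (sigma + t + l%:R)); last by rewrite Re_natD ltr_wpDr.
rewrite (invfM (poch (sigma + t + l%:R) k)).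
have h1 : poch sigma k != 0 by apply: poch_neq0 => i; exact: Re_gt0_neq0.
have h2 : poch P k != 0 by apply: poch_neq0 => i; exact: Re_gt0_neq0.
set g := (Gamma (sigma + t + l%:R))^-1.
set g2 := (poch (sigma + t + l%:R) k)^-1.
clearbody g g2; move: (Gamma P) (Gamma sigma) => GP Gs.
by field; rewrite h1 h2.
Qed.

Lemma hahn_sum_lt n l P sigma t : (l < n)%N ->
  0 < complex.Re P -> 0 < complex.Re sigma -> 0 < complex.Re t ->
  \sum_(k < n.+1) (-1) ^+ k * 'C(n, k)%:R *
    (poch (n%:R + sigma + t - 1) k / (poch sigma k * poch P k)) *
    (Gamma (P + k%:R) * Gamma (sigma + k%:R + l%:R) / Gamma (sigma + t + k%:R + l%:R)) = 0.
Proof.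
move=> ln P0 s0 t0; rewrite hahn_sum_Gamma//.
have st0 : 0 < complex.Re (sigma + t) by rewrite raddfD/= addr_gt0.
(* With m = n - l - 1 the upper parameter n+σ+t-1 equals D + m for D = σ+t+l, as the polynomial case
   requires. *)
have -> : n = (l + (n - l.+1)).+1 by lia.
set m := (n - l.+1)%N.
have -> : (l + m).+1%:R + sigma + t - 1 = sigma + t + l%:R + m%:R.
  by rewrite -natr1 natrD; ring.
rewrite sum_binomial_poch_lt ?mulr0// => i.
by apply: Re_gt0_neq0; rewrite Re_natD ltr_wpDr.
Qed.

Lemma hahn_sum_eq n P sigma t :
  0 < complex.Re P -> 0 < complex.Re sigma -> 0 < complex.Re t ->
  \sum_(k < n.+1) (-1) ^+ k * 'C(n, k)%:R *
    (poch (n%:R + sigma + t - 1) k / (poch sigma k * poch P k)) *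
    (Gamma (P + k%:R) * Gamma (sigma + k%:R + n%:R) / Gamma (sigma + t + k%:R + n%:R)) =
  (-1) ^+ n * n`!%:R * Gamma P * Gamma sigma * poch t n / Gamma (sigma + t + (2 * n)%:R).
Proof.
move=> P0 s0 t0; rewrite hahn_sum_Gamma//.
have st0 : 0 < complex.Re (sigma + t) by rewrite raddfD/= addr_gt0.
have stn0 : 0 < complex.Re (sigma + t + n%:R) by rewrite Re_natD ltr_wpDr.
have AE : n%:R + sigma + t - 1 + 1 = sigma + t + n%:R by ring.
have := @sum_binomial_poch_eq n (n%:R + sigma + t - 1) sigma.
rewrite AE => ->; last 2 first.
- by move=> i; exact: Re_gt0_neq0.
- case: (n) => // k _; have -> : k.+1%:R + sigma + t - 1 = sigma + t + k%:R.
    by rewrite -natr1; ring.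
  exact: Re_gt0_neq0.
(* The remainder (σ-A)_n becomes (-1)^n (t)_n by reversing the order of the factors. *)
have -> : sigma - (n%:R + sigma + t - 1) = 1 - t - n%:R by ring.
rewrite poch_reflect.
have -> : sigma + t + (2 * n)%:R = sigma + t + n%:R + n%:R by rewrite mul2n -addnn natrD addrA.
rewrite (Gamma_poch n stn0) (invfM (poch (sigma + t + n%:R) n)).
set g := (Gamma (sigma + t + n%:R))^-1.
set g2 := (poch (sigma + t + n%:R) n)^-1.
clearbody g g2; move: (Gamma P) (Gamma sigma) => GP Gs.
by ring.
Qed.

(** The (k,l) term of the one-dimensional integral up to the factor 4πΓ(t). For common tail N the
    parameters are P = N + |a^j|, Q = N + |b^j|, sigma = 2N + |a^(j+1)| + |b^(j+1)| and t = a_j +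
    b_j. *)
Definition hahn_coef n m P Q sigma t k l : R[i] :=
  (-1) ^+ k * 'C(n, k)%:R * (poch (n%:R + sigma + t - 1) k / (poch sigma k * poch P k)) *
  ((-1) ^+ l * 'C(m, l)%:R * (poch (m%:R + sigma + t - 1) l / (poch sigma l * poch Q l))) *
  (Gamma (P + k%:R) * Gamma (Q + l%:R) * Gamma (sigma + k%:R + l%:R)
    / Gamma (sigma + t + k%:R + l%:R)).

Lemma hahn_coefC n m P Q sigma t k l :
  hahn_coef n m P Q sigma t k l = hahn_coef m n Q P sigma t l k.
Proof.
rewrite /hahn_coef [sigma + l%:R + _]addrAC [sigma + t + l%:R + _]addrAC.
move: (Gamma (P + _)) (Gamma (Q + _)) (Gamma (sigma + _ + _)) (Gamma (sigma + t + _ + _)).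
by move=> gP gQ gs gst; ring.
Qed.

Lemma sum_hahn_coef_inner n m P Q sigma t (l : nat) :
  \sum_(k < n.+1) hahn_coef n m P Q sigma t k l =
  (-1) ^+ l * 'C(m, l)%:R * (poch (m%:R + sigma + t - 1) l / (poch sigma l * poch Q l))
   * Gamma (Q + l%:R) *
  \sum_(k < n.+1) (-1) ^+ k * 'C(n, k)%:R *
    (poch (n%:R + sigma + t - 1) k / (poch sigma k * poch P k)) *
    (Gamma (P + k%:R) * Gamma (sigma + k%:R + l%:R) / Gamma (sigma + t + k%:R + l%:R)).
Proof.
rewrite mulr_sumr; apply: eq_bigr => k _; rewrite /hahn_coef.
move: (Gamma (P + _)) (Gamma (Q + _)) (Gamma (sigma + _ + _)) (Gamma (sigma + t + _ + _)).
by move=> gP gQ gs gst; ring.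
Qed.

Lemma sum_hahn_coef_lt n m P Q sigma t : (m < n)%N ->
  0 < complex.Re P -> 0 < complex.Re Q -> 0 < complex.Re sigma -> 0 < complex.Re t ->
  \sum_(k < n.+1) \sum_(l < m.+1) hahn_coef n m P Q sigma t k l = 0.
Proof.
move=> mn P0 Q0 s0 t0; rewrite exchange_big/= big1// => l _.
rewrite sum_hahn_coef_inner hahn_sum_lt ?mulr0//.
by rewrite (leq_ltn_trans _ mn)// -ltnS.
Qed.

Lemma sum_hahn_coef_neq n m P Q sigma t : n != m ->
  0 < complex.Re P -> 0 < complex.Re Q -> 0 < complex.Re sigma -> 0 < complex.Re t ->
  \sum_(k < n.+1) \sum_(l < m.+1) hahn_coef n m P Q sigma t k l = 0.
Proof.
rewrite neq_ltn => /orP[nm|mn] P0 Q0 s0 t0; last exact: sum_hahn_coef_lt.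
rewrite exchange_big/= -[RHS](sum_hahn_coef_lt nm Q0 P0 s0 t0).
by apply: eq_bigr => l _; apply: eq_bigr => k _; exact: hahn_coefC.
Qed.

Lemma sum_hahn_coef_eq n P Q sigma t :
  0 < complex.Re P -> 0 < complex.Re Q -> 0 < complex.Re sigma -> 0 < complex.Re t ->
  \sum_(k < n.+1) \sum_(l < n.+1) hahn_coef n n P Q sigma t k l =
  n`!%:R * Gamma P * Gamma Q * Gamma sigma * poch t n * poch (n%:R + sigma + t - 1) n
    / (poch sigma n * Gamma (sigma + t + (2 * n)%:R)).
Proof.
move=> P0 Q0 s0 t0; rewrite exchange_big/=.
rewrite big_ord_recr/= big1 ?add0r; last first.
  by move=> l _; rewrite sum_hahn_coef_inner hahn_sum_lt// mulr0.
rewrite sum_hahn_coef_inner hahn_sum_eq// binn (Gamma_poch n Q0) (invfM (poch sigma n) (Gamma (sigma + t + _))).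
have h1 : poch sigma n != 0 by apply: poch_neq0 => i; exact: Re_gt0_neq0.
have h2 : poch Q n != 0 by apply: poch_neq0 => i; exact: Re_gt0_neq0.
set g := (Gamma (sigma + t + _))^-1.
(* One sign comes from the coefficient at l = n, the other from the reflected Pochhammer symbol;
   they cancel. *)
have e1 : (-1) ^+ n * (-1) ^+ n = 1 :> R[i] by rewrite -exprMn mulrNN mulr1 expr1n.
set s := (-1) ^+ n in e1 *.
clearbody g; move: (Gamma P) (Gamma Q) (Gamma sigma) => GP GQ Gs.
transitivity (s * s * (n`!%:R * GP * GQ * Gs * poch t n *
  poch (n%:R + sigma + t - 1) n * ((poch sigma n)^-1 * g))); last by rewrite e1 mul1r.
by field; rewrite h1 h2.
Qed.

End hahn_sums.

(** * The one-dimensional integrals *)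

Section hahn_weight.
Context {R : realType}.
Local Notation mu := (@lebesgue_measure R).
Implicit Types (p q x al be : R) (n m k l N M : nat).

(** The j-th factor of [weight], with p, al, q, be standing for a_j, |a^(j+1)|, b_j, |b^(j+1)|. *)
Definition hahn_weight p al q be x : R[i] :=
  Gamma (p%:C - 'i%C * x%:C / 2) * Gamma (al%:C + 'i%C * x%:C / 2) *
  Gamma (q%:C + 'i%C * x%:C / 2) * Gamma (be%:C - 'i%C * x%:C / 2).

(** Barnes' value 2π(...), doubled by the substitution of x/2 for x. *)
Definition barnes_value p al q be : R[i] :=
  2 * (2 * pi%:C * (Gamma (al + p)%:C * Gamma (q + be)%:C *
    (Gamma (al + be)%:C * Gamma (q + p)%:C) / Gamma (al + q + p + be)%:C)).

Lemma half_imaginary x : 'i%C * x%:C / 2 = 0 +i* (2^-1 * x) :> R[i].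
Proof.
have -> : (2 : R[i])^-1 = (2^-1)%:C by rewrite fmorphV rmorph_nat.
by apply/eqP; rewrite eq_complex/=; apply/andP; split; apply/eqP; ring.
Qed.

Lemma has_cintegral_half (f : measurableTypeR R -> R[i]) v : has_cintegral mu f v ->
  has_cintegral mu (fun x => f (2^-1 * x)) (2 * v).
Proof.
move=> [[fr fi] <-].
have h0 : (0 : R) < 2^-1 by rewrite invr_gt0.
have ri := integrable_affine 0 h0 fr; have ii := integrable_affine 0 h0 fi.
split; first split.
- by apply: eq_integrable ri => // x _ /=; rewrite addr0.
- by apply: eq_integrable ii => // x _ /=; rewrite addr0.
rewrite /cintegral (Rintegral_affine 0 h0 fr) (Rintegral_affine 0 h0 fi).
have -> : (2 : R[i]) = 2%:C by rewrite rmorph_nat.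
apply/eqP; rewrite eq_complex/= !mul0r subr0 addr0 !mulrA mulfV// !mul1r.
by apply/andP; split; apply/eqP; apply: eq_Rintegral => x _; rewrite addr0.
Qed.

Lemma has_cintegral_hahn_weight p al q be : 0 < p -> 0 < al -> 0 < q -> 0 < be ->
  has_cintegral mu (hahn_weight p al q be) (barnes_value p al q be).
Proof.
move=> p0 al0 q0 be0.
have := has_cintegral_half (barnes_first_lemma al0 q0 p0 be0).
apply: has_cintegral_eq => // x; rewrite /hahn_weight !half_imaginary.
have hp c : c%:C + 0 +i* (2^-1 * x) = c +i* (2^-1 * x) :> R[i].
  by apply/eqP; rewrite eq_complex/= addr0 add0r !eqxx.
have hm c : c%:C - 0 +i* (2^-1 * x) = c +i* - (2^-1 * x) :> R[i].
  by apply/eqP; rewrite eq_complex/= subr0 add0r !eqxx.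
rewrite !hp !hm.
move: (Gamma _) (Gamma _) (Gamma _) (Gamma _) => g1 g2 g3 g4; ring.
Qed.

Lemma hahn_weight_shift p al q be k l x : 0 < al -> 0 < be ->
  hahn_weight p al q be x * (poch (al%:C + 'i%C * x%:C / 2) k * poch (be%:C - 'i%C * x%:C / 2) l) =
  hahn_weight p (al + k%:R) q (be + l%:R) x.
Proof.
move=> al0 be0; rewrite /hahn_weight !rmorphD/= !rmorph_nat ![_%:C + _%:R + _]addrAC.
rewrite !Gamma_poch; last 2 first.
- by rewrite half_imaginary/= subr0.
- by rewrite half_imaginary/= addr0.
move: (Gamma _) (Gamma _) (Gamma _) (Gamma _) => g1 g2 g3 g4; ring.
Qed.

(** The prefactor and the k-th numerator combine as (α+ix/2)_N (α+N+ix/2)_k = (α+ix/2)_(N+k), which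
    shifts a Gamma argument. The tails [N] and [M] are independent here, because integrability and a
    value are needed also for coordinates where they differ. *)
Lemma has_cintegral_hahn_product p al q be n m N M (c2 d1 d2 e2 f1 f2 : R[i]) :
  0 < p -> 0 < al -> 0 < q -> 0 < be ->
  has_cintegral mu (fun x : measurableTypeR R => hahn_weight p al q be x
    * (poch (al%:C + 'i%C * x%:C / 2) N *
       hyp3F2 (- n%:R) c2 (N%:R + al%:C + 'i%C * x%:C / 2) d1 d2 1)
    * (poch (be%:C + - 'i%C * x%:C / 2) M *
       hyp3F2 (- m%:R) e2 (M%:R + be%:C + - 'i%C * x%:C / 2) f1 f2 1))
  (\sum_(k < n.+1) \sum_(l < m.+1)
     ((-1) ^+ k * 'C(n, k)%:R * (poch c2 k / (poch d1 k * poch d2 k))) *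
     ((-1) ^+ l * 'C(m, l)%:R * (poch e2 l / (poch f1 l * poch f2 l))) *
     barnes_value p (al + (N + k)%:R) q (be + (M + l)%:R)).
Proof.
move=> p0 al0 q0 be0.
have hw k l : has_cintegral mu (hahn_weight p (al + (N + k)%:R) q (be + (M + l)%:R))
    (barnes_value p (al + (N + k)%:R) q (be + (M + l)%:R)).
  by apply: has_cintegral_hahn_weight => //; rewrite ltr_wpDr.
pose c k l : R[i] := ((-1) ^+ k * 'C(n, k)%:R * (poch c2 k / (poch d1 k * poch d2 k))) *
     ((-1) ^+ l * 'C(m, l)%:R * (poch e2 l / (poch f1 l * poch f2 l))).
have hs := has_cintegral_sum (fun k : 'I_n.+1 => has_cintegral_sum (fun l : 'I_m.+1 =>
  has_cintegralZ (c k l) (hw k l))).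
apply: has_cintegral_eq hs => // x.
rewrite !hyp3F2_negn !mulNr.
have distr (W A B : R[i]) (F : 'I_n.+1 -> R[i]) (G : 'I_m.+1 -> R[i]) :
    W * (A * \sum_k F k) * (B * \sum_l G l) = \sum_k \sum_l W * (A * F k) * (B * G l).
  rewrite [A * _]mulr_sumr [W * _]mulr_sumr mulr_suml; apply: eq_bigr => k _.
  by rewrite [B * _]mulr_sumr mulr_sumr.
rewrite distr; apply: eq_bigr => k _; apply: eq_bigr => l _.
rewrite -hahn_weight_shift// !pochD /c.
have swap (A B C : R[i]) : A + B + C = B + C + A by ring.
rewrite (swap N%:R) (swap M%:R).
move: (hahn_weight _ _ _ _ _) (poch (_ + N%:R) k) (poch (_ + M%:R) l) => w u v.
ring.
Qed.

End hahn_weight.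

Section hahn_orthogonality.
Context {R : realType}.
Implicit Types (p q al be c : R) (n m k l N : nat).

(** Generically this is Γ(z+1) = zΓ(z) applied along (c+k)_k and once more. The delicate case is k =
    0 with c <= 0, which occurs when the sum of the parameters is at most 1. *)
Lemma h_denE c k : -1 < c ->
  h_den c k * poch (c + k%:R)%:C k = Gamma (c + 1 + (2 * k)%:R)%:C.
Proof.
move=> c1; rewrite /h_den; case: k => [|k] /=.
  rewrite poch0 mulr1 muln0 !addr0; case: eqP => [->|/eqP c0].
    by rewrite add0r -[RHS]/(Gamma 1) Gamma1.
  rewrite mulr0 addr0; have [cp|cn] := ltP 0 c.
    by rewrite rmorphD/= GammaS.
  have {cn c0}cn : c < 0 by rewrite lt_neqAle c0.
  have c10 : 0 < c + 1 by lra.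
  (* For -1 < c < 0 the definition of [Gamma] takes exactly one continuation step, Γ(c) =
     Γ(c+1)/c. *)
  have tr : Num.truncn (- c) = 0%N by apply: truncn_def; apply/andP; split; lra.
  rewrite /Gamma /= ltNge (ltW cn) /= tr c10 addr0 poch0 divr1 /poch big_ord1 addr0.
  have -> : c%:C + 1 = (c + 1)%:C :> R[i] by rewrite rmorphD.
  by rewrite mulrC divfK// eq_complex/= eqxx andbT lt_eqF.
have ck : 0 < c + k.+1%:R by rewrite -nat1r addrA ltr_wpDr//; lra.
rewrite -mulrA [Gamma _ * _]mulrC -Gamma_poch//.
have -> : (c + k.+1%:R)%:C + k.+1%:R = (c + (2 * k.+1)%:R)%:C :> R[i].
  by rewrite -(rmorph_nat (real_complex R)) -rmorphD/= -addrA -natrD addnn mul2n.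
have -> : c + 1 + (2 * k.+1)%:R = c + (2 * k.+1)%:R + 1 :> R by rewrite addrAC.
rewrite [in RHS]rmorphD/= GammaS; last by rewrite /= mul2n -addnn natrD addrA ltr_wpDr.
by rewrite natrM.
Qed.

Lemma h_den_neq0 c k : -1 < c -> h_den c k != 0.
Proof.
move=> c1; have : Gamma (c + 1 + (2 * k)%:R)%:C != 0 :> R[i].
  by apply: Gamma_gt0_neq0; rewrite ltr_wpDr//; lra.
by rewrite -h_denE// mulf_eq0 negb_or => /andP[].
Qed.

Lemma barnes_valueE p al q be N k l :
  barnes_value p (al + (N + k)%:R) q (be + (N + l)%:R) =
  4 * pi%:C * Gamma (p + q)%:C *
  (Gamma ((N%:R + (p + al))%:C + k%:R) * Gamma ((N%:R + (q + be))%:C + l%:R) *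
   Gamma ((2 * N%:R + al + be)%:C + k%:R + l%:R) /
   Gamma ((2 * N%:R + al + be)%:C + (p + q)%:C + k%:R + l%:R)).
Proof.
rewrite /barnes_value -!(rmorph_nat (real_complex R)) -!rmorphD/= !natrD.
have -> : al + (N%:R + k%:R) + p = N%:R + (p + al) + k%:R :> R by ring.
have -> : q + (be + (N%:R + l%:R)) = N%:R + (q + be) + l%:R :> R by ring.
have -> : al + (N%:R + k%:R) + (be + (N%:R + l%:R)) = 2 * N%:R + al + be + k%:R + l%:R :> R by ring.
have -> : al + (N%:R + k%:R) + q + p + (be + (N%:R + l%:R)) =
  2 * N%:R + al + be + (p + q) + k%:R + l%:R :> R by ring.
have -> : q + p = p + q by rewrite addrC.
rewrite !(rmorph_nat (real_complex R)).
have -> : 4 = 2 * 2 :> R[i] by rewrite -natrM.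
move: (Gamma _) (Gamma _) (Gamma _) (Gamma _) (Gamma _) => g1 g2 g3 g4 g5; ring.
Qed.

(** The closed form of the double sum has (n+σ+t-1)_n over Γ(σ+t+2n). By [h_denE] with c = σ+t-1,
    this quotient is the inverse of [h_den], which yields the j-th factors of [h_const] and of the
    norm. *)
Lemma hahn_orthogonality p al q be n m N :
  0 < p -> 0 < al -> 0 < q -> 0 < be ->
  let sigma : R[i] := (2 * N%:R + al + be)%:C in
  let t : R[i] := (p + q)%:C in
  let P : R[i] := (N%:R + (p + al))%:C in
  let Q : R[i] := (N%:R + (q + be))%:C in
  \sum_(k < n.+1) \sum_(l < m.+1)
     ((-1) ^+ k * 'C(n, k)%:R * (poch (n%:R + sigma + t - 1) k / (poch sigma k * poch P k))) *
     ((-1) ^+ l * 'C(m, l)%:R * (poch (m%:R + sigma + t - 1) l / (poch sigma l * poch Q l))) *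
     barnes_value p (al + (N + k)%:R) q (be + (N + l)%:R) =
  4 * pi%:C *
    (Gamma (2 * N%:R + al + be + n%:R)%:C * Gamma (1 + (p + q - 1) + n%:R)%:C /
      (n`!%:R * h_den (2 * N%:R + al + be + (p + q - 1)) n)) *
    (n`!%:R ^+ 2 * Gamma P * Gamma Q / poch sigma n ^+ 2 * (n == m)%:R).
Proof.
move=> p0 al0 q0 be0 sigma t P Q.
have s0 : 0 < 2 * N%:R + al + be by rewrite -addrA ltr_wpDl ?mulr_ge0//; lra.
have P0 : 0 < N%:R + (p + al) by rewrite ltr_wpDl//; lra.
have Q0 : 0 < N%:R + (q + be) by rewrite ltr_wpDl//; lra.
have t0 : 0 < p + q by lra.
transitivity (4 * pi%:C * Gamma t * \sum_(k < n.+1) \sum_(l < m.+1) hahn_coef n m P Q sigma t k l).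
  rewrite mulr_sumr; apply: eq_bigr => k _; rewrite mulr_sumr; apply: eq_bigr => l _.
  rewrite barnes_valueE /hahn_coef -/sigma -/P -/Q -/t.
  move: (Gamma t) (Gamma (P + _)) (Gamma (Q + _)) (Gamma (sigma + _ + _)) (Gamma (sigma + t + _ + _)).
  by move=> g1 g2 g3 g4 g5; ring.
have [<-{m}|nm] := eqVneq n m; last by rewrite sum_hahn_coef_neq// !mulr0.
rewrite sum_hahn_coef_eq// mulr1.
have -> : 1 + (p + q - 1) + n%:R = p + q + n%:R by ring.
have c1 : -1 < 2 * N%:R + al + be + (p + q - 1) by lra.
have := h_denE n c1; have := h_den_neq0 n c1.
set c := 2 * N%:R + al + be + (p + q - 1); set hd := h_den c n => hd0.
have -> : c + 1 + (2 * n)%:R = 2 * N%:R + al + be + (p + q) + (2 * n)%:R by rewrite /c; ring.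
have -> : (c + n%:R)%:C = n%:R + sigma + t - 1.
  rewrite /sigma /t -!(rmorph_nat (real_complex R)) -(rmorph1 (real_complex R)) -!rmorphD -rmorphB/=.
  by congr (_%:C); rewrite /c; ring.
have -> : (2 * N%:R + al + be + (p + q) + (2 * n)%:R)%:C = sigma + t + (2 * n)%:R.
  by rewrite /sigma /t -(rmorph_nat (real_complex R)) -!rmorphD.
have G0 : Gamma (sigma + t + (2 * n)%:R) != 0.
  rewrite /sigma /t -(rmorph_nat (real_complex R)) -!rmorphD/=.
  by apply: Gamma_gt0_neq0; rewrite ltr_wpDr// addr_gt0.
move=> hdE; rewrite -hdE in G0 *.
have pp0 : poch (n%:R + sigma + t - 1) n != 0 by move: G0; rewrite mulf_eq0 negb_or => /andP[].
have ps0 : poch sigma n != 0 by apply: poch_neq0 => i; exact: Re_gt0_neq0.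
have -> : Gamma (2 * N%:R + al + be + n%:R)%:C = poch sigma n * Gamma sigma.
  by rewrite -Gamma_poch// /sigma rmorphD/= rmorph_nat.
have -> : Gamma (p + q + n%:R)%:C = poch t n * Gamma t.
  by rewrite -Gamma_poch// /t rmorphD/= rmorph_nat.
have n0 : (n`!%:R : R[i]) != 0 by rewrite pnatr_eq0 -lt0n fact_gt0.
move: (Gamma P) (Gamma Q) (Gamma sigma) (Gamma t) => gP gQ gs gt.
clear hdE; clearbody hd.
by field; rewrite n0 hd0 pp0 ps0.
Qed.

End hahn_orthogonality.

(** * Tail sums and the continuous Hahn form *)

Section tails.
Context {R : realType} {r : nat}.
Implicit Types (a b : 'I_r.+1 -> R) (j : 'I_r).

Lemma rtail_entry a j : rtail a j = entry a j + rtail a j.+1.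
Proof.
rewrite /rtail (bigD1 (widen_ord (leqnSn r) j))//=; congr (_ + _).
by apply: eq_bigl => i; rewrite ltn_neqAle andbC eq_sym.
Qed.

Lemma rtail_gt0 a k : (forall i, 0 < a i) -> (k <= r)%N -> 0 < rtail a k.
Proof.
move=> a0 kr; rewrite /rtail (bigD1 ord_max)//= ltr_wpDr//.
by apply: sumr_ge0 => i _; exact: ltW.
Qed.

(** There are r - j indices above [j] in ['I_r.+1]; the summand [r - j] of [h_const] restores the
    ones subtracted in a + b - 1. *)
Lemma rtail_addB1 a b j :
  rtail (fun i => a i + b i - 1) j.+1 + (r - j)%:R = rtail a j.+1 + rtail b j.+1.
Proof.
rewrite /rtail sumrB big_split/= -[RHS]addr0 -addrA; congr (_ + _).
have -> : \sum_(i < r.+1 | (j < i)%N) (1 : R) = (r - j)%:R.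
  by rewrite -(big_geq_mkord j.+1 r.+1 xpredT (fun=> 1 : R)) sumr_const_nat subSS.
by rewrite addNr.
Qed.

Lemma ntail_eq (n m : 'I_r -> nat) k : (forall i : 'I_r, (k <= i)%N -> n i = m i) ->
  ntail n k = ntail m k.
Proof. by move=> nm; apply: eq_bigr => i /nm. Qed.

(** The argument -ix/2 is chosen so that i(-ix/2) = x/2, which makes the two 3F2 coincide.
    Positivity of the parameters keeps the cancelled Pochhammer symbols nonzero. *)
Lemma S_funE (n : 'I_r -> nat) a b (x : 'I_r -> R[i]) :
  (forall i, 0 < a i) -> (forall i, 0 < b i) ->
  S_fun n x a b = S_fun_hahn n x a b.
Proof.
move=> a0 b0; apply: eq_bigr => j _ /=; rewrite /continuous_hahn.
have ta0 : 0 < rtail a j.+1 by exact: rtail_gt0.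
have tb0 : 0 < rtail b j.+1 by exact: rtail_gt0.
have ea0 : 0 < entry a j by exact: a0.
rewrite !rtail_entry !rmorphD/=.
set N : R[i] := (ntail n j.+1)%:R; set al := (rtail a j.+1)%:C; set be := (rtail b j.+1)%:C.
set p := (entry a j)%:C; set q := (entry b j)%:C.
have -> : (n j)%:R + (N + al) + q + (N + be) + p - 1 =
  (n j)%:R + 2 * N + (p + al) + (q + be) - 1 by ring.
have -> : N + al + 'i%C * (- 'i%C * x j / 2) = N + al + x j / 2.
  by rewrite mulNr mulNr mulrN -!mulrA [_ * (_ * (_ / _))]mulrA -expr2 sqr_i mulN1r opprK.
have -> : N + al + (N + be) = 2 * N + al + be by ring.
have -> : N + al + p = N + (p + al) by ring.
have i0 : ('i%C : R[i]) ^+ n j != 0.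
  by apply: expf_neq0; rewrite eq_complex/= negb_and oner_eq0 orbT.
have n0 : ((n j)`!%:R : R[i]) != 0 by rewrite pnatr_eq0 -lt0n fact_gt0.
have h1 : poch (2 * N + al + be) (n j) != 0.
  apply: poch_neq0 => i; apply: Re_gt0_neq0.
  rewrite /N /al /be -(natrM _ 2) -(rmorph_nat (real_complex R)) -!rmorphD/=.
  by rewrite -addrA ltr_wpDl// addr_gt0.
have h2 : poch (N + (p + al)) (n j) != 0.
  apply: poch_neq0 => i; apply: Re_gt0_neq0.
  rewrite /N /al /p -(rmorph_nat (real_complex R)) -!rmorphD/=.
  by rewrite ltr_wpDl// addr_gt0.
move: (hyp3F2 _ _ _ _ _ _) => H.
by field; rewrite h1 h2 i0 n0.
Qed.

End tails.

(** * The multivariate orthogonality relation *)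

Unset Implicit Arguments.

Theorem theorem4p2 (R : realType) (r : nat) (hr : (1 <= r)%N)
    (n m : 'I_r -> nat) (a b : 'I_r.+1 -> R)
    (ha : forall j, 0 < a j) (hb : forall j, 0 < b j) :
  let integrand (x : euclidean R r) : R[i] :=
    weight (tnth x) a b
    * S_fun n (fun j => 'i%C * (tnth x j)%:C) a b
    * S_fun m (fun j => - 'i%C * (tnth x j)%:C) b a in
  (forall x : 'I_r -> R[i], S_fun n x a b = S_fun_hahn n x a b) /\
  cintegrable (lebesgue_measure_n R r) setT integrand /\
  cintegral (lebesgue_measure_n R r) setT integrand
  = 2 ^+ (2 * r) * pi%:C ^+ r
    * h_const n (fun j => a j + b j - 1)
    * \prod_(j < r)
        ((n j)`!%:R ^+ 2
         * Gamma ((ntail n j.+1)%:R + rtail a j)%:C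
         * Gamma ((ntail n j.+1)%:R + rtail b j)%:C
         / poch (2 * (ntail n j.+1)%:R + rtail a j.+1 + rtail b j.+1)%:C (n j)
             ^+ 2
         * (n j == m j)%:R).

Proof.
move=> integrand; split; first by move=> x; exact: S_funE.
have ea0 j : 0 < entry a j by exact: ha.
have eb0 j : 0 < entry b j by exact: hb.
have ta0 (j : 'I_r) : 0 < rtail a j.+1 by exact: rtail_gt0.
have tb0 (j : 'I_r) : 0 < rtail b j.+1 by exact: rtail_gt0.
pose val (j : 'I_r) : R[i] := \sum_(k < (n j).+1) \sum_(l < (m j).+1)
  ((-1) ^+ k * 'C(n j, k)%:R *
     (poch ((n j)%:R + 2 * (ntail n j.+1)%:R + (rtail a j)%:C + (rtail b j)%:C - 1) k /
       (poch (2 * (ntail n j.+1)%:R + (rtail a j.+1)%:C + (rtail b j.+1)%:C) k *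
        poch ((ntail n j.+1)%:R + (rtail a j)%:C) k))) *
  ((-1) ^+ l * 'C(m j, l)%:R *
     (poch ((m j)%:R + 2 * (ntail m j.+1)%:R + (rtail b j)%:C + (rtail a j)%:C - 1) l /
       (poch (2 * (ntail m j.+1)%:R + (rtail b j.+1)%:C + (rtail a j.+1)%:C) l *
        poch ((ntail m j.+1)%:R + (rtail b j)%:C) l))) *
  barnes_value (entry a j) (rtail a j.+1 + (ntail n j.+1 + k)%:R) (entry b j)
    (rtail b j.+1 + (ntail m j.+1 + l)%:R).
pose coef (j : 'I_r) : R[i] :=
  let c : R := 2 * (ntail n j.+1)%:R + rtail (fun i => a i + b i - 1) j.+1 + (r - j)%:R in
  Gamma (c + (n j)%:R)%:C * Gamma (1 + entry (fun i => a i + b i - 1) j + (n j)%:R)%:C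
     / ((n j)`!%:R * h_den (c + entry (fun i => a i + b i - 1) j) (n j)).
pose norm (j : 'I_r) : R[i] := (n j)`!%:R ^+ 2
  * Gamma ((ntail n j.+1)%:R + rtail a j)%:C
  * Gamma ((ntail n j.+1)%:R + rtail b j)%:C
  / poch (2 * (ntail n j.+1)%:R + rtail a j.+1 + rtail b j.+1)%:C (n j) ^+ 2
  * (n j == m j)%:R.
(* [val j] is defined with both tails and is evaluated only where they agree. *)
have valE (j : 'I_r) : ntail n j.+1 = ntail m j.+1 -> val j = 4 * pi%:C * coef j * norm j.
  move=> nm; have := hahn_orthogonality (n j) (m j) (ntail n j.+1) (ea0 j) (ta0 j) (eb0 j) (tb0 j).
  rewrite /val -nm !rtail_entry /coef /norm => /= h.
  have cE : 2 * (ntail n j.+1)%:R + rtail (fun i => a i + b i - 1) j.+1 + (r - j)%:R =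
    2 * (ntail n j.+1)%:R + rtail a j.+1 + rtail b j.+1 :> R.
    by rewrite -addrA rtail_addB1 addrA.
  rewrite cE {cE} !rtail_entry -[entry (fun i => a i + b i - 1) j]/(entry a j + entry b j - 1) -h.
  apply: eq_bigr => k _; apply: eq_bigr => l _.
  rewrite !rmorphD !rmorphM/= !rmorph_nat.
  congr (_ * (poch _ k / _) * (_ * (poch _ l / (poch _ l * _))) * _); ring.
have main : has_cintegral (lebesgue_measure_n R r) integrand (\prod_(j < r) val j).
  have := has_cintegral_prod_tuple (fun j =>
    has_cintegral_hahn_product (n j) (m j) (ntail n j.+1) (ntail m j.+1)
     ((n j)%:R + 2 * (ntail n j.+1)%:R + (rtail a j)%:C + (rtail b j)%:C - 1)
     (2 * (ntail n j.+1)%:R + (rtail a j.+1)%:C + (rtail b j.+1)%:C)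
     ((ntail n j.+1)%:R + (rtail a j)%:C)
     ((m j)%:R + 2 * (ntail m j.+1)%:R + (rtail b j)%:C + (rtail a j)%:C - 1)
     (2 * (ntail m j.+1)%:R + (rtail b j.+1)%:C + (rtail a j.+1)%:C)
     ((ntail m j.+1)%:R + (rtail b j)%:C)
     (ea0 j) (ta0 j) (eb0 j) (tb0 j)).
  apply: has_cintegral_eq => // x.
  by rewrite /integrand /weight /S_fun -!big_split.
case: main => ci ->; split => //.
rewrite /h_const -/(\prod_(j < r) norm j) -/(\prod_(j < r) coef j).
have [/forallP nm|] := boolP [forall j, n j == m j].
  transitivity (\prod_(j < r) (4 * pi%:C * coef j * norm j)).
    by apply: eq_bigr => j _; apply: valE; apply: ntail_eq => i _; exact/eqP.
  rewrite !big_split/= !prodr_const !card_ord; congr (_ * _ * _ * _).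
  (* The factor 4 of each coordinate collects to 4^r = 2^(2r). *)
  by rewrite exprM expr2 -natrM.
rewrite negb_forall => /existsP[j0 nmj0].
have [j nmj jmax] := @arg_maxnP _ j0 (fun j : 'I_r => n j != m j) (@nat_of_ord r) nmj0.
have norm0 : norm j = 0 by rewrite /norm (negbTE nmj) mulr0.
rewrite (bigD1 j)//= valE ?norm0; last first.
  apply: ntail_eq => i ji; apply/eqP; apply: contraTT ji => nmi.
  by rewrite -leqNgt; exact: jmax.
(* A single zero factor settles each side; the coordinates below [j], whose tails may differ, are
   never evaluated. *)
by rewrite mulr0 mul0r [X in _ * X](bigD1 j)//= norm0 mul0r mulr0.
Qed.
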